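(* Let $X$ and $Y$ be Banach spaces and let $\Omega$ be a compact Hausdorff space with Borel $\sigma$-algebra $\Sigma$. Let $1\le p\le\infty$. Assume that $U\in\mathcal{L}(\mathcal{C}_p(\Omega,X),Y)$, let $m:\Sigma\to\mathcal{L}(X,Y^{**})$ be its representing measure, and let $\mu:\Sigma\to\mathcal{L}(X,Y)^{**}$ be the (classical) representing measure of the associated operator $U^{\#}\in\mathcal{L}(\mathcal{C}(\Omega),\mathcal{L}(X,Y))$, $(U^{\#}\varphi)x=U(\varphi x)$. Then $m(E)=PJ^{**}\mu(E)$ for all $E\in\Sigma$, where $J:\mathcal{L}(X,Y)\to\mathcal{L}(X,Y^{**})$, $J(A)=j_YA$, and $P=(j_{X\hat{\otimes}_\pi Y^*})^*:\mathcal{L}(X,Y^{**})^{**}\to\mathcal{L}(X,Y^{**})$, with $\mathcal{L}(X,Y^{**})=(X\hat{\otimes}_\pi Y^* )^*$. Moreover, if $U^{\#}$ is weakly compact, then $m$ takes its values in $\mathcal{L}(X,Y)$, and the measures $m$ and $\mu$ coincide. In this case, the measure $m:\Sigma\to\mathcal{L}(X,Y)$ is countably additive and regular.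
   Context: Banach spaces are over the same field $\mathbb{K}$ ($\mathbb{R}$ or $\mathbb{C}$); $\mathcal{L}$ denotes bounded linear operators and $B_Z$ the closed unit ball of $Z$. $j_Z:Z\to Z^{**}$ is the canonical embedding of a Banach space $Z$, and $Z$ is regarded as a subspace of $Z^{**}$; thus $\mathcal{L}(X,Y)\subset\mathcal{L}(X,Y^{**})$ and $\mathcal{L}(X,Y)\subset\mathcal{L}(X,Y)^{**}$. $p'$ is the conjugate index of $p$ ($1/p+1/p'=1$, $1/\infty=0$). $\mathcal{C}(\Omega)$, $\mathcal{C}(\Omega,X)$ are the spaces of continuous scalar-, resp. $X$-valued functions. $\mathcal{B}(\Sigma)$ is the Banach space of uniform limits of sequences of $\Sigma$-simple scalar functions. $\mathcal{C}_p(\Omega,X)$ consists of all $f\in\mathcal{C}(\Omega,X)$ for which there is $(x_n)\in\ell_p(X)$ (absolutely $p$-summable; $(x_n)\in c_0(X)$ if $p=\infty$) with $f(\Omega)\subset\{\sum_n\alpha_nx_n:(\alpha_n)\in B_{\ell_{p'}}\}$, with norm the infimum of $\|(x_n)\|_p$ over such sequences. It is a Banach space, in which the linear span of the functions $\varphi x$ ($\varphi\in\mathcal{C}(\Omega)$, $x\in X$) is dense, and $\mathcal{C}_p(\Omega,X)^*=\mathcal{P}_{p'}(\mathcal{C}(\Omega),X^* )$ isometrically under $\langle\varphi x,T\rangle=\langle x,T\varphi\rangle$, where $\mathcal{P}_q$ is the ideal of absolutely $q$-summing operators with its norm ($\mathcal{P}_\infty=\mathcal{L}$; $\|T\|_{\mathcal{P}_q}=\infty$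 if $T\notin\mathcal{P}_q$). A vector measure $m:\Sigma\to Z$ is a finitely additive set function; its semivariation on $F\in\Sigma$ is $\|m\|(F)=\sup\|\sum_i\varepsilon_im(E_i)\|$ over finite partitions $(E_i)\subset\Sigma$ of $F$ and scalars $|\varepsilon_i|\le1$; $m$ is bounded if $\|m\|(\Omega)<\infty$; $m$ is regular if for every $E\in\Sigma$, $\varepsilon>0$ there are compact $K$ and open $O$ with $K\subset E\subset O$, $\|m\|(O\setminus K)<\varepsilon$. For bounded $m$, $\int_\Omega\varphi\,dm$ is defined for $\varphi\in\mathcal{B}(\Sigma)$ by $\int_\Omega\chi_E\,dm=m(E)$, linearity, and density. For bounded $m:\Sigma\to\mathcal{L}(X,Y^{**})$ and $y^*\in Y^*$, $m_{y^*}:\Sigma\to X^*$ is given by $\langle x,m_{y^*}(E)\rangle=\langle y^*,m(E)x\rangle$, and $I_{y^*}\in\mathcal{L}(\mathcal{C}(\Omega),X^* )$ is $I_{y^*}\varphi=\int_\Omega\varphi\,dm_{y^*}$. The $q$-semivariation is $\|m\|_q(\Omega)=\sup_{y^*\in B_{Y^*}}\|I_{y^*}\|_{\mathcal{P}_q}$; $m$ is of bounded $q$-semivariation if $m$ is bounded and $\|m\|_q(\Omega)<\infty$. If $\|m\|_{p'}(\Omega)<\infty$, the integral $\int_\Omega f\,dm\in Y^{**}$, $f\in\mathcal{C}_p(\Omega,X)$, is the unique bounded linear extension to $\mathcal{C}_p(\Omega,X)$ of $\varphi x\mapsto(\int_\Omega\varphi\,dm)x$, $\varphi\in\mathcal{C}(\Omega)$,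 $x\in X$. A representing measure of $U\in\mathcal{L}(\mathcal{C}_p(\Omega,X),Y)$ is a vector measure $m:\Sigma\to\mathcal{L}(X,Y^{**})$ of bounded $p'$-semivariation with $Uf=\int_\Omega f\,dm$ for all $f\in\mathcal{C}_p(\Omega,X)$. By the Bartle--Dunford--Schwartz theorem, for every operator $T\in\mathcal{L}(\mathcal{C}(\Omega),Z)$ ($Z$ a Banach space) there exists a unique bounded vector measure $G:\Sigma\to Z^{**}$ such that $T\varphi=\int_\Omega\varphi\,dG$ for all $\varphi\in\mathcal{C}(\Omega)$; $G$ is called the classical representing measure of $T$. Here it is applied with $Z=\mathcal{L}(X,Y)$. The identification $\mathcal{L}(X,Y^{**})=(X\hat{\otimes}_\pi Y^* )^*$ ($\pi$ the projective tensor norm) is given by $\langle x\otimes y^*,A\rangle=\langle y^*,Ax\rangle$.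
   Formalization: The representing measures m and μ are additionally required to be weak-star regular (E ↦ ⟨y*, m(E)x⟩ and E ↦ ⟨w, μ(E)⟩ regular for all x, y*, w), since without regularity a bounded representing measure is not unique and the first claim fails. *)

(* Defs.v *)
From HB Require Import structures.
From mathcomp Require Import all_boot all_order all_algebra.
From mathcomp Require Import complex.
From mathcomp Require Import all_classical all_reals all_analysis.

Set Implicit Arguments.
Unset Strict Implicit.
Unset Printing Implicit Defensive.

Import Order.TTheory GRing.Theory Num.Theory.
Import numFieldNormedType.Exports.

Local Open Scope classical_set_scope.
Local Open Scope ring_scope.

Inductive scalar_kind := RealScalars | ComplexScalars.

Definition scalars (R : realType) (k : scalar_kind) : numFieldType :=
  match k with RealScalars => R | ComplexScalars => R[i] end.

Section scalars.
Variables (R : realType) (k : scalar_kind).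
Local Notation K := (scalars R k).

Definition reK : K -> R :=
  match k return scalars R k -> R with
  | RealScalars => id
  | ComplexScalars => @complex.Re R
  end.

Definition ofR : R -> K :=
  match k return R -> scalars R k with
  | RealScalars => id
  | ComplexScalars => fun x => (x%:C)%C
  end.

Lemma ofRK : cancel ofR reK.
Proof. by rewrite /ofR /reK; case: k. Qed.

Lemma reKK (z : K) : 0 <= z -> ofR (reK z) = z.
Proof.
rewrite /ofR /reK; move: z; case: k => //= -[a b].
by rewrite lecE /= => /andP[/eqP -> _].
Qed.

Lemma ofR_le (x y : R) : (ofR x <= ofR y) = (x <= y).
Proof. by rewrite /ofR; case: k => //=; rewrite lecR. Qed.

Lemma ofRD (x y : R) : ofR (x + y) = ofR x + ofR y.
Proof. by rewrite /ofR; case: k => //=; rewrite rmorphD. Qed.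

Lemma ofRM (x y : R) : ofR (x * y) = ofR x * ofR y.
Proof. by rewrite /ofR; case: k => //=; rewrite rmorphM. Qed.

Lemma ofR0 : ofR 0 = 0.
Proof. by rewrite /ofR; case: k. Qed.

Lemma ofR1 : ofR 1 = 1.
Proof. by rewrite /ofR; case: k. Qed.

(* Norms of [normedModType K] take their values in the nonnegative elements of
   [K]; [rnorm] is the same norm as a real number. *)
Definition rnorm (V : normedZmodType K) (x : V) : R := reK `|x|.

Lemma rnormE (V : normedZmodType K) (x : V) : ofR (rnorm x) = `|x|.
Proof. exact: reKK. Qed.

Section rnorm_zmod.
Variable V : normedZmodType K.
Implicit Types x y : V.

Lemma rnorm_le x (c : R) : (rnorm x <= c) = (`|x| <= ofR c).
Proof. by rewrite -rnormE ofR_le. Qed.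

Lemma rnorm_ge0 x : 0 <= rnorm x.
Proof. by rewrite -ofR_le rnormE ofR0. Qed.

Lemma rnormD x y : rnorm (x + y) <= rnorm x + rnorm y.
Proof. by rewrite rnorm_le ofRD !rnormE ler_normD. Qed.

Lemma rnorm0_eq0 x : rnorm x = 0 -> x = 0.
Proof. by move=> x0; apply/normr0_eq0; rewrite -rnormE x0 ofR0. Qed.

Lemma rnorm0 : rnorm (0 : V) = 0.
Proof. by rewrite -[LHS]ofRK rnormE normr0 -ofR0 ofRK. Qed.

Lemma rnormN x : rnorm (- x) = rnorm x.
Proof. by rewrite /rnorm normrN. Qed.

End rnorm_zmod.

Lemma rnormZ (V : normedModType K) (a : K) (x : V) :
  rnorm (a *: x) = rnorm a * rnorm x.
Proof. by rewrite -[RHS]ofRK ofRM !rnormE /rnorm normrZ. Qed.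

Lemma rnorm_ofR (x : R) : 0 <= x -> rnorm (ofR x : K) = x.
Proof. by move=> x0; rewrite /rnorm ger0_norm ?ofRK// -ofR0 ofR_le. Qed.

Lemma rnormV (a : K) : rnorm a^-1 = (rnorm a)^-1.
Proof.
have [->|a0] := eqVneq a 0; first by rewrite invr0 !rnorm0 invr0.
have na0 : rnorm a != 0.
  by apply: contra_neq a0 => na0; apply/normr0_eq0; rewrite -rnormE na0 ofR0.
apply: (mulfI na0); rewrite divff// -(rnormZ (V := K^o)) /GRing.scale/=.
by rewrite divff// /rnorm normr1 -ofR1 ofRK.
Qed.

End scalars.
Arguments ofR {R k}.
Arguments reK {R k}.
Arguments rnorm {R k V} x.

Section opnorm.
Variables (R : realType) (k : scalar_kind).
Local Notation K := (scalars R k).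
Variables X Y : normedModType K.

(* Also used for maps not known to be linear and bounded. *)
Definition opnorm (f : X -> Y) : \bar R :=
  ereal_sup [set (rnorm (f x))%:E | x in [set x | rnorm x <= 1]].

Definition bounded_linear (f : X -> Y) : Prop :=
  linear f /\ exists M : R, forall x, rnorm (f x) <= M * rnorm x.

Definition blinear : {pred X -> Y} := mem [set f | bounded_linear f].

Lemma blinear_submod_closed : submod_closed blinear.
Proof.
split.
  rewrite inE; split.
    by move=> a x y; rewrite -[RHS]/(a *: 0 + 0) scaler0 addr0.
  by exists 0 => x; rewrite -[X in rnorm X]/0 rnorm0 mul0r.
move=> a f g; rewrite !inE => -[lf [M fM]] [lg [N gN]]; split.
  by move=> b x y; rewrite !fctE lf lg !scalerDr !scalerA [a * b]mulrC addrACA.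
exists (rnorm (a : K) * M + N) => x; rewrite mulrDl.
rewrite (le_trans (rnormD _ _))// lerD// rnormZ -mulrA.
by rewrite ler_wpM2l// rnorm_ge0.
Qed.

HB.instance Definition _ := GRing.isSubmodClosed.Build K (X -> Y) blinear
  blinear_submod_closed.

(* The space of bounded linear operators. *)
Record bop := BOp { bop_fun :> X -> Y; bop_subproof : bop_fun \in blinear }.

HB.instance Definition _ := [isSub for bop_fun].
HB.instance Definition _ := [Choice of bop by <:].
HB.instance Definition _ := [SubChoice_isSubLmodule of bop by <:].

Lemma bopP (f : bop) : bounded_linear f.
Proof. by have := bop_subproof f; rewrite inE. Qed.

Lemma bounded_linear_in (f : X -> Y) : bounded_linear f -> f \in blinear.
Proof. by rewrite inE. Qed.

Definition mkbop (f : X -> Y) (fP : bounded_linear f) : bop :=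
  BOp (bounded_linear_in fP).

Lemma bop_eqP (f g : bop) : f =1 g -> f = g.
Proof. by move=> fg; apply/val_inj/funext. Qed.

Lemma bopD (f : bop) x y : f (x + y) = f x + f y.
Proof. by have [lf _] := bopP f; have := lf 1 x y; rewrite !scale1r. Qed.

Lemma bop0 (f : bop) : f 0 = 0.
Proof. by apply: (addrI (f 0)); rewrite -bopD !addr0. Qed.

Lemma bopZ (f : bop) a x : f (a *: x) = a *: f x.
Proof.
by have [lf _] := bopP f; have := lf a x 0; rewrite bop0 !addr0.
Qed.

Lemma opnorm_ge0 (f : bop) : (0 <= opnorm f)%E.
Proof.
apply: ereal_sup_ubound; exists 0; first by rewrite /= rnorm0.
by rewrite bop0 rnorm0.
Qed.

Lemma opnorm_le (f : X -> Y) (M : R) : 0 <= M ->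
  (forall x, rnorm (f x) <= M * rnorm x) -> (opnorm f <= M%:E)%E.
Proof.
move=> M0 fM; apply: ge_ereal_sup => _ [x /= x1 <-]; rewrite lee_fin.
by rewrite (le_trans (fM x))// ler_piMr.
Qed.

Lemma opnorm_fin (f : bop) : opnorm f \is a fin_num.
Proof.
have [_ [M fM]] := bopP f.
rewrite ge0_fin_numE ?opnorm_ge0//.
apply: (@le_lt_trans _ _ (`|M|%:E)); last exact: ltry.
apply: opnorm_le => // x; rewrite (le_trans (fM x))//.
by rewrite ler_wpM2r ?rnorm_ge0// ler_norm.
Qed.

Definition bop_norm (f : bop) : K := ofR (fine (opnorm f)).

Lemma le_opnorm (f : bop) x : rnorm (f x) <= fine (opnorm f) * rnorm x.
Proof.
have [->|x0] := eqVneq x 0; first by rewrite bop0 !rnorm0 mulr0.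
have nx0 : 0 < rnorm x.
  rewrite lt_neqAle rnorm_ge0 andbT eq_sym.
  by apply: (contra_neq _ x0) => /rnorm0_eq0.
rewrite -ler_pdivrMr// -lee_fin fineK ?opnorm_fin//.
apply: ereal_sup_ubound; exists (ofR (rnorm x)^-1 *: x).
  by rewrite /= rnormZ rnorm_ofR ?invr_ge0 ?rnorm_ge0// mulVf ?gt_eqF.
by rewrite bopZ rnormZ rnorm_ofR ?invr_ge0 ?rnorm_ge0// mulrC.
Qed.

Lemma bop_normD (f g : bop) : bop_norm (f + g) <= bop_norm f + bop_norm g.
Proof.
rewrite /bop_norm -ofRD ofR_le -lee_fin fineK ?opnorm_fin//.
apply: opnorm_le => [|x]; first by rewrite addr_ge0 ?fine_ge0 ?opnorm_ge0.
by rewrite mulrDl (le_trans (rnormD _ _))// lerD ?le_opnorm.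
Qed.

Lemma opnormZ_le (a : K) (f : bop) :
  fine (opnorm (a *: f)) <= rnorm a * fine (opnorm f).
Proof.
rewrite -lee_fin fineK ?opnorm_fin//.
apply: opnorm_le => [|x].
  by rewrite mulr_ge0 ?rnorm_ge0 ?fine_ge0 ?opnorm_ge0.
rewrite -mulrA -[X in rnorm X]/(a *: f x) rnormZ.
by rewrite ler_wpM2l ?rnorm_ge0 ?le_opnorm.
Qed.

Lemma bop_normZ (a : K) (f : bop) : bop_norm (a *: f) = `|a| * bop_norm f.
Proof.
rewrite /bop_norm -rnormE -ofRM; congr ofR; apply/eqP.
rewrite eq_le opnormZ_le/=.
have [->|a0] := eqVneq a 0.
  by rewrite rnorm0 mul0r fine_ge0//; exact: (opnorm_ge0 (0 *: f)).
have na0 : 0 < rnorm a.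
  rewrite lt_neqAle rnorm_ge0 andbT eq_sym.
  by apply: (contra_neq _ a0) => /rnorm0_eq0.
rewrite -ler_pdivlMl//; have := opnormZ_le a^-1 (a *: f).
rewrite scalerA mulVf// scale1r => /le_trans; apply.
by rewrite rnormV.
Qed.

Lemma bop_norm0_eq0 (f : bop) : bop_norm f = 0 -> f = 0.
Proof.
move=> f0; apply: bop_eqP => x; apply: rnorm0_eq0; apply/eqP.
rewrite eq_le rnorm_ge0 andbT (le_trans (le_opnorm f x))//.
suff -> : fine (opnorm f) = 0 by rewrite mul0r.
by rewrite -[LHS](@ofRK _ k) -/(bop_norm f) f0 -ofR0 ofRK.
Qed.

HB.instance Definition _ :=
  Lmodule_isNormed.Build K bop bop_normD bop_normZ bop_norm0_eq0.

End opnorm.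
Arguments bop {R k} X Y.
Arguments opnorm {R k X Y} f.
Arguments bounded_linear {R k X Y} f.

Notation dual X := (bop X (scalars _ _)^o).
Notation bidual X := (dual (dual X)).

Section operators.
Variables (R : realType) (k : scalar_kind).
Local Notation K := (scalars R k).
Variables X Y Z : normedModType K.

Lemma bcomp_subproof (g : bop Y Z) (f : bop X Y) : bounded_linear (g \o f).
Proof.
split=> [a x y|] /=; first by rewrite bopD !bopZ bopD bopZ.
exists (fine (opnorm g) * fine (opnorm f)) => x /=.
rewrite (le_trans (le_opnorm g (f x)))// -mulrA ler_wpM2l ?le_opnorm//.
by rewrite fine_ge0 ?opnorm_ge0.
Qed.

Definition bcomp (g : bop Y Z) (f : bop X Y) : bop X Z :=
  mkbop (bcomp_subproof g f).

Lemma rnorm_bcomp (g : bop Y Z) (f : bop X Y) :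
  rnorm (bcomp g f) <= rnorm g * rnorm f.
Proof.
rewrite /rnorm !ofRK -lee_fin fineK ?opnorm_fin//.
apply: opnorm_le => [|x].
  by rewrite mulr_ge0 ?fine_ge0 ?opnorm_ge0.
rewrite (le_trans (le_opnorm g (f x)))// -mulrA ler_wpM2l ?le_opnorm//.
by rewrite fine_ge0 ?opnorm_ge0.
Qed.

Lemma precomp_subproof (f : bop X Y) :
  bounded_linear (fun g : bop Y Z => bcomp g f).
Proof.
split=> [a g h|]; first exact: bop_eqP.
by exists (rnorm f) => g; rewrite mulrC rnorm_bcomp.
Qed.

Definition precomp (f : bop X Y) : bop (bop Y Z) (bop X Z) :=
  mkbop (precomp_subproof f).

Lemma postcomp_subproof (g : bop Y Z) :
  bounded_linear (fun f : bop X Y => bcomp g f).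
Proof.
split=> [a f h|]; first by apply: bop_eqP => x; rewrite /= bopD bopZ.
by exists (rnorm g) => f; rewrite rnorm_bcomp.
Qed.

Definition postcomp (g : bop Y Z) : bop (bop X Y) (bop X Z) :=
  mkbop (postcomp_subproof g).

Lemma eval_subproof (x : X) : bounded_linear (fun f : dual X => f x : K^o).
Proof.
split=> [a f g //|]; exists (rnorm x) => f.
by rewrite mulrC (le_trans (le_opnorm f x))// /rnorm ofRK lexx.
Qed.

Definition eval_at (x : X) : bidual X := mkbop (eval_subproof x).

Lemma canonical_embedding_subproof : bounded_linear eval_at.
Proof.
split=> [a x y|]; first by apply: bop_eqP => f; rewrite /= bopD bopZ.
exists 1 => x; rewrite mul1r [leLHS]ofRK -lee_fin fineK ?opnorm_fin//.
by apply: opnorm_le => [|f]; [exact: rnorm_ge0|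
  rewrite mulrC (le_trans (le_opnorm f x))// /rnorm ofRK lexx].
Qed.

Definition canonical_embedding : bop X (bidual X) :=
  mkbop canonical_embedding_subproof.

End operators.
Arguments precomp {R k X Y} Z f.
Arguments postcomp {R k} X {Y Z} g.
Arguments canonical_embedding {R k} X.

Definition adjoint (R : realType) (k : scalar_kind)
    (X Y : normedModType (scalars R k)) (T : bop X Y) :
    bop (dual Y) (dual X) :=
  precomp (scalars R k)^o T.

Notation biadjoint T := (adjoint (adjoint T)).

HB.mixin Record isCompactHausdorff T & Topological T := {
  compactT : compact [set: T];
  hausdorffT : hausdorff_space T
}.

#[short(type="compactHausdorffType")]
HB.structure Definition CompactHausdorff :=
  {T of Topological T & isCompactHausdorff T}.

Section cfun.
Variables (R : realType) (k : scalar_kind).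
Local Notation K := (scalars R k).
Variables (Omega : compactHausdorffType) (X : normedModType K).

Definition continuous_pred : {pred Omega -> X} :=
  mem [set f : Omega -> X | continuous f].

Lemma continuous_submod_closed : submod_closed continuous_pred.
Proof.
split; first by rewrite inE => x; exact: cvg_cst.
move=> a f g; rewrite !inE => cf cg x.
by apply: cvgD; [apply: cvgZ; [exact: cvg_cst|exact: cf]|exact: cg].
Qed.

HB.instance Definition _ := GRing.isSubmodClosed.Build K (Omega -> X)
  continuous_pred continuous_submod_closed.

Record cfun :=
  CFun { cfun_fun :> Omega -> X; cfun_subproof : cfun_fun \in continuous_pred }.

HB.instance Definition _ := [isSub for cfun_fun].
HB.instance Definition _ := [Choice of cfun by <:].
HB.instance Definition _ := [SubChoice_isSubLmodule of cfun by <:].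

Lemma cfunP (f : cfun) : continuous f.
Proof. by have := cfun_subproof f; rewrite inE. Qed.

Lemma continuous_in (f : Omega -> X) : continuous f -> f \in continuous_pred.
Proof. by rewrite inE. Qed.

Definition mkcfun (f : Omega -> X) (fP : continuous f) : cfun :=
  CFun (continuous_in fP).

Definition supnorm (f : Omega -> X) : R :=
  sup [set rnorm (f w) | w in [set: Omega]].

Lemma ler_rnormB (x y : X) : `|rnorm x - rnorm y| <= rnorm (x - y).
Proof.
rewrite ler_norml; apply/andP; split.
  rewrite lerNl opprB lerBlDr -[rnorm (x - y)]rnormN opprB.
  by rewrite -{1}(subrK x y) rnormD.
by rewrite lerBlDr -{1}(subrK y x) rnormD.
Qed.

Lemma rnorm_continuous : continuous (rnorm : X -> R).
Proof.
move=> x; apply/cvgrPdist_lt => e e0.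
have e0' : 0 < ofR e :> K.
  rewrite lt_neqAle -{2}ofR0 ofR_le (ltW e0) andbT eq_sym.
  apply: contra_neq (lt0r_neq0 e0) => h.
  by rewrite -[e](@ofRK _ k) h -ofR0 ofRK.
near=> y; rewrite (le_lt_trans (ler_rnormB x y))//.
have : `|x - y| < ofR e.
  by near: y; exact: (
    @cvgr_dist_lt _ _ _ (nbhs x) _ id x (@cvg_id _ _) _ e0').
rewrite -rnormE !lt_neqAle ofR_le => /andP[ne ->]; rewrite andbT.
by apply: contraNneq ne => ->.
Unshelve. all: by end_near. Qed.

Lemma cfun_has_ubound (f : cfun) :
  has_ubound [set rnorm (f w) | w in [set: Omega]].
Proof.
have := @continuous_compact _ _ (rnorm \o f) setT.
have cf : continuous (rnorm \o f : Omega -> R).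
  by move=> w; apply: continuous_comp; [exact: cfunP|exact: rnorm_continuous].
move=> /(_ (continuous_subspaceT cf) compactT) /compact_bounded.
move=> [M [_ /(_ (M + 1))]]; rewrite ltrDl ltr01 => /(_ erefl) MP.
by exists (M + 1) => _ [w _ <-]; rewrite (le_trans (ler_norm _))// MP//;
  exists w.
Qed.

Lemma le_supnorm (f : cfun) w : rnorm (f w) <= supnorm f.
Proof. by apply: ub_le_sup; [exact: cfun_has_ubound|exists w]. Qed.

Lemma supnorm_le (f : Omega -> X) M : 0 <= M ->
  (forall w, rnorm (f w) <= M) -> supnorm f <= M.
Proof.
move=> M0 fM; rewrite /supnorm; set S := [set _ | _ in _].
have [->|/set0P S0] := eqVneq S set0; first by rewrite sup0.
by apply: ge_sup => // _ [w _ <-].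
Qed.

Lemma supnorm_ge0 (f : Omega -> X) : 0 <= supnorm f.
Proof.
have [hS|hS] := pselect (has_sup [set rnorm (f w) | w in [set: Omega]]).
  have [[_ [w _ _]] ub] := hS.
  by apply: (le_trans (rnorm_ge0 (f w))); apply: ub_le_sup => //; exists w.
by rewrite /supnorm sup_out.
Qed.

Definition cfun_norm (f : cfun) : K := ofR (supnorm f).

Lemma cfun_normD (f g : cfun) : cfun_norm (f + g) <= cfun_norm f + cfun_norm g.
Proof.
rewrite /cfun_norm -ofRD ofR_le; apply: supnorm_le => [|w].
  by rewrite addr_ge0 ?supnorm_ge0.
by rewrite (le_trans (rnormD (f w) (g w)))// lerD ?le_supnorm.
Qed.

Lemma supnormZ_le (a : K) (f : cfun) : supnorm (a *: f) <= rnorm a * supnorm f.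
Proof.
apply: supnorm_le => [|w]; first by rewrite mulr_ge0 ?rnorm_ge0 ?supnorm_ge0.
by rewrite -[X in rnorm X]/(a *: f w) rnormZ ler_wpM2l ?rnorm_ge0 ?le_supnorm.
Qed.

Lemma cfun_normZ (a : K) (f : cfun) : cfun_norm (a *: f) = `|a| * cfun_norm f.
Proof.
rewrite /cfun_norm -rnormE -ofRM; congr ofR; apply/eqP.
rewrite eq_le supnormZ_le/=.
have [->|a0] := eqVneq a 0; first by rewrite rnorm0 mul0r supnorm_ge0.
have na0 : 0 < rnorm a.
  rewrite lt_neqAle rnorm_ge0 andbT eq_sym.
  by apply: (contra_neq _ a0) => /rnorm0_eq0.
rewrite -ler_pdivlMl//; have := supnormZ_le a^-1 (a *: f).
by rewrite scalerA mulVf// scale1r rnormV.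
Qed.

Lemma cfun_norm0_eq0 (f : cfun) : cfun_norm f = 0 -> f = 0.
Proof.
move=> f0; apply/val_inj/funext => w; apply: rnorm0_eq0; apply/eqP.
rewrite eq_le rnorm_ge0 andbT (le_trans (le_supnorm f w))//.
by rewrite -[leLHS](@ofRK _ k) -/(cfun_norm f) f0 -ofR0 ofRK.
Qed.

HB.instance Definition _ :=
  Lmodule_isNormed.Build K cfun cfun_normD cfun_normZ cfun_norm0_eq0.

End cfun.
Arguments cfun {R k} Omega X.

Section cfun_scale.
Variables (R : realType) (k : scalar_kind) (Omega : compactHausdorffType).
Variable X : normedModType (scalars R k).

Lemma cfun_scale_subproof (phi : cfun Omega (scalars R k)^o) (x : X) :
  continuous (fun w : Omega => phi w *: x).
Proof. by move=> w; apply: cvgZ; [exact: cfunP|exact: cvg_cst]. Qed.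

Definition cfun_scale (phi : cfun Omega (scalars R k)^o) (x : X) :
    cfun Omega X :=
  @mkcfun _ _ _ _ (fun w => phi w *: x) (@cfun_scale_subproof phi x).

End cfun_scale.

Section vector_measure.
Variables (R : realType) (k : scalar_kind) (Omega : topologicalType).
Local Notation K := (scalars R k).
Variable Z : normedModType K.
Implicit Types m : set Omega -> Z.

(* A vector measure is a function on all subsets of [Omega] of which only the
   values on Borel sets are used. *)
Definition borel : set (set Omega) := <<s open >>.

Definition finitely_additive m : Prop := forall A B, borel A -> borel B ->
  A `&` B = set0 -> m (A `|` B) = m A + m B.

Definition countably_additive m : Prop := forall A : nat -> set Omega,
  (forall n, borel (A n)) -> trivIset setT A ->
  (\sum_(0 <= i < n) m (A i)) @[n --> \oo] --> m (\bigcup_n A n).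

Definition semivariation m (F : set Omega) : \bar R :=
  ereal_sup [set r | exists n (A : 'I_n -> set Omega) (e : 'I_n -> K),
    [/\ forall i, borel (A i), trivIset setT A, \bigcup_i A i = F,
        forall i, rnorm (e i) <= 1
      & r = (rnorm (\sum_(i < n) e i *: m (A i)))%:E]].

Definition bounded_measure m : Prop := (semivariation m setT < +oo)%E.

Definition regular_measure m : Prop := forall E (e : R), borel E -> 0 < e ->
  exists C O, [/\ compact C, open O, C `<=` E, E `<=` O
    & (semivariation m (O `\` C) < e%:E)%E].

Definition simple_fun (s : Omega -> K) : Prop :=
  finite_set (range s) /\ forall a, borel (s @^-1` [set a]).

Definition simple_fun_integral m (s : Omega -> K) : Z :=
  \sum_(a \in range s) a *: m (s @^-1` [set a]).

Definition is_vector_integral m (phi : Omega -> K) (z : Z) : Prop :=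
  exists s : nat -> Omega -> K,
    [/\ forall n, simple_fun (s n), {uniform, s @ \oo --> phi}
      & simple_fun_integral m (s n) @[n --> \oo] --> z].

(* The limit exists and does not depend on the approximating sequence when [m]
   is bounded and finitely additive, [Z] is complete and [phi] is a uniform
   limit of simple functions. *)
Definition vector_integral m (phi : Omega -> K) : Z :=
  xget 0 [set z | is_vector_integral m phi z].

End vector_measure.

Section weak.
Variables (R : realType) (k : scalar_kind).
Local Notation K := (scalars R k).

Definition weak (Z : normedModType K) : topologicalType :=
  initial_topology (fun z : Z => (fun f => f z) : {ptws dual Z -> K^o}).

Definition weakly_compact (X Z : normedModType K) (T : bop X Z) : Prop :=
  precompact ([set T x | x in [set x | rnorm x <= 1]] : set (weak Z)).

End weak.

Section summing.
Variables (R : realType) (k : scalar_kind).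
Local Notation K := (scalars R k).

Definition weak_lnorm (Z : normedModType K) (r : R) n (z : 'I_n -> Z) :
    \bar R :=
  ereal_sup [set ((\sum_(i < n) rnorm (f (z i)) `^ r) `^ r^-1)%:E
            | f in [set f : dual Z | rnorm f <= 1]].

Definition summing_norm (Z W : normedModType K) (q : \bar R) (T : Z -> W) :
    \bar R :=
  if q is r%:E then
    ereal_inf [set C%:E | C in [set C : R | 0 <= C /\
      forall n (z : 'I_n -> Z),
        (((\sum_(i < n) rnorm (T (z i)) `^ r) `^ r^-1)%:E
          <= C%:E * weak_lnorm r z)%E]]
  else opnorm T.

End summing.

Section Cp.
Variables (R : realType) (k : scalar_kind) (Omega : compactHausdorffType).
Local Notation K := (scalars R k).
Variable X : normedModType K.

Definition ellp_norm (V : normedModType K) (p : \bar R) (x : nat -> V) :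
    \bar R :=
  'N[counting]_p[(fun n => (rnorm (x n))%:E)]%E.

(* [c_0] for [p = +oo] *)
Definition ellp (p : \bar R) : set (nat -> X) :=
  [set x | if p == +oo%E then x @ \oo --> 0 else (ellp_norm p x < +oo)%E].

Definition ellp_hull (p : \bar R) (x : nat -> X) : set X :=
  [set y | exists2 a : nat -> K^o, (ellp_norm (hoelder_conjugate p) a <= 1)%E &
    (\sum_(0 <= i < n) a i *: x i) @[n --> \oo] --> y].

Definition Cp_generators (p : \bar R) (f : cfun Omega X) : set (nat -> X) :=
  [set x | ellp p x /\ range f `<=` ellp_hull p x].

Definition Cp (p : \bar R) : set (cfun Omega X) :=
  [set f | Cp_generators p f !=set0].

Definition Cp_norm (p : \bar R) (f : cfun Omega X) : \bar R :=
  ereal_inf [set ellp_norm p x | x in Cp_generators p f].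

Definition Cp_bounded_linear (Y : normedModType K) (p : \bar R)
    (U : cfun Omega X -> Y) : Prop :=
  (forall (a : K) f g, Cp p f -> Cp p g -> U (a *: f + g) = a *: U f + U g) /\
  exists M : R, forall f, Cp p f -> ((rnorm (U f))%:E <= M%:E * Cp_norm p f)%E.

End Cp.

Section representing_measures.
Variables (R : realType) (k : scalar_kind) (Omega : compactHausdorffType).
Local Notation K := (scalars R k).
Local Notation C := (cfun Omega K^o).

(* A bounded additive set function on the Borel sets is not determined by the
   integrals of continuous functions unless it is regular; the representation
   theorems produce, and are unique among, measures regular in this weak-star
   sense. *)
Definition weakstar_regular (W : normedModType K) (m : set Omega -> dual W) :
    Prop :=
  forall w : W, regular_measure (fun E => m E w : K^o).

Record classical_representing_measure (Z : normedModType K) (T : bop C Z)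
    (G : set Omega -> bidual Z) : Prop := {
  classical_additive : finitely_additive G;
  classical_bounded : bounded_measure G;
  classical_regular : weakstar_regular G;
  classical_integral : forall phi : C,
    canonical_embedding Z (T phi) = vector_integral G phi
}.

Variables X Y : normedModType K.
Implicit Types m : set Omega -> bop X (bidual Y).

Definition measure_at m (y : dual Y) (E : set Omega) : dual X :=
  bcomp (canonical_embedding (dual Y) y) (m E).

Definition integral_at m (y : dual Y) (phi : C) : dual X :=
  vector_integral (measure_at m y) phi.

Definition q_semivariation (q : \bar R) m : \bar R :=
  ereal_sup [set summing_norm q (integral_at m y)
            | y in [set y : dual Y | rnorm y <= 1]].

Definition bounded_q_semivariation (q : \bar R) m : Prop :=
  bounded_measure m /\ (q_semivariation q m < +oo)%E.

Definition Cp_integral (p : \bar R) m (I : cfun Omega X -> bidual Y) : Prop :=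
  Cp_bounded_linear p I /\
  forall (phi : C) (x : X),
    I (cfun_scale phi x) = (vector_integral m phi : bop X (bidual Y)) x.

Record representing_measure (p : \bar R) (U : cfun Omega X -> Y) m : Prop := {
  representing_additive : finitely_additive m;
  representing_bounded : bounded_q_semivariation (hoelder_conjugate p) m;
  representing_regular : forall y : dual Y, weakstar_regular (measure_at m y);
  representing_integral : exists2 I, Cp_integral p m I &
    forall f, Cp p f -> canonical_embedding Y (U f) = I f
}.

End representing_measures.

Section projective_tensor.
Variables (R : realType) (k : scalar_kind).
Local Notation K := (scalars R k).
Variables X V : normedModType K.

Definition bilinear_map (Z : lmodType K) (b : X -> V -> Z) : Prop :=
  (forall x, linear (b x)) /\ (forall v, linear (b^~ v)).

(* The image of the formal sum of the tensors [i.1 (x) i.2], [i] in [s]. *)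
Definition tensor_sum (Z : lmodType K) (b : X -> V -> Z) (s : seq (X * V)) :
    Z :=
  \sum_(i <- s) b i.1 i.2.

Definition projective_norm (Z : lmodType K) (b : X -> V -> Z) (z : Z) : R :=
  inf [set \sum_(i <- s) rnorm i.1 * rnorm i.2
      | s in [set s | tensor_sum b s = z]].

(* [T] is a completion of the algebraic tensor product of [X] and [V] for the
   projective norm; [tensor_injective] says that the linear map induced by [t]
   on the algebraic tensor product is injective. *)
Record projective_tensor (T : completeNormedModType K) (t : X -> V -> T) :
    Prop := {
  tensor_bilinear : bilinear_map t;
  tensor_injective : forall s, tensor_sum t s = 0 ->
    forall b : X -> V -> K^o, bilinear_map b -> tensor_sum b s = 0;
  tensor_norm : forall s,
    rnorm (tensor_sum t s) = projective_norm t (tensor_sum t s);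
  tensor_dense : closure (range (tensor_sum t)) = setT
}.

End projective_tensor.

(* Main.v *)
Require Import Defs.
From mathcomp Require Import all_boot all_order all_algebra.
From mathcomp Require Import complex.
From mathcomp Require Import all_classical all_reals all_analysis ess_sup_inf.
From mathcomp Require Import lra ring.

Set Implicit Arguments.
Unset Strict Implicit.
Unset Printing Implicit Defensive.

Import Order.TTheory GRing.Theory Num.Theory.
Import numFieldNormedType.Exports.

Local Open Scope classical_set_scope.
Local Open Scope ring_scope.

(** Everything is tested on scalars. For [x] in [X] and [y] in the dual of [Y],
    the image of [mu E] under the biadjoint of [J] and [P] sends [x] and [y] to
    the value of [mu E] at the functional [A |-> y (A x)] on operators
    ([tensor_functional]). So the first claim says that two scalar measures
    agree: [E |-> m E x y] and [E |-> mu E (tensor_functional x y)]. Both are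
    regular, bounded and finitely additive, and both integrate every continuous
    [phi] to [y (U (phi x))]. Such integrals determine a regular measure: if a
    compact set inside [E] and an open set around [E] differ little, the
    integral of a Urysohn function between them is close to the measure of [E]
    ([integral_near_measure], [regular_measures_eq]). The integrals exist
    because spaces of operators are complete ([vector_integralP]).

    One Urysohn function serves finitely many functionals at once
    ([common_bump]), so that [mu E] is in the weak-star closure of the image of
    the unit ball under [Us]. If [Us] is weakly compact, [mu E] is therefore
    represented by an operator [m0 E] ([weakly_compact_bidual]), and the first
    claim yields [m = J m0].

    It remains to see that [m0], whose compositions with functionals are
    regular, is regular for the norm ([weakly_regular_regular]). If it is not
    at some set [E], compact sets inside [E] and open sets around [E] can be
    improved forever, each time removing from the shell between them a set whose
    measure is bounded below ([shrink_shell]). The removed sets are disjoint,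
    while the measures of disjoint sets tend to [0] by the Orlicz-Pettis theorem
    ([orlicz_pettis]). That theorem is proved by Baire category: the measures of
    the unions of the disjoint sets form a weakly continuous image of the
    Cantor space, contained in a separable subspace, hence they are nearly
    constant on some cylinder. Finally, by compactness, regularity implies
    countable additivity ([regular_countably_additive]).

    Functionals come from the Hahn-Banach theorem, for real and for complex
    scalars ([seminorm_functional]): it gives norming functionals and, applied
    to the distance to a subspace, Mazur's theorem. *)

(** * Real and complex scalars *)

Section scalar_facts.
Variables (R : realType) (k : scalar_kind).
Local Notation K := (scalars R k).

Lemma reKD (a b : K) : reK (a + b) = reK a + reK b.
Proof. by case: k a b => //= -[? ?] [? ?]. Qed.

Lemma reK_le (a : K) : `|reK a| <= rnorm a.
Proof.
rewrite -(ofR_le k) rnormE; case: k a => //= a.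
exact: normc_ge_Re.
Qed.

(** Real scalars are treated like complex ones, with [0] in the role of the
    imaginary unit, so that few proofs distinguish the two cases. *)
Definition iK : K :=
  match k return scalars R k with
  | RealScalars => 0
  | ComplexScalars => 'i%C
  end.

Definition imK : K -> R :=
  match k return scalars R k -> R with
  | RealScalars => fun=> 0
  | ComplexScalars => @complex.Im R
  end.

Lemma iK_cases : iK = 0 \/ iK * iK = -1.
Proof.
rewrite /iK; case: k; [by left|right]; apply/eqP.
by rewrite eq_complex /= !mul0r !mulr0 mul1r sub0r addr0 oppr0 !eqxx.
Qed.

Lemma reK_iKM (r : R) : reK (iK * ofR r) = 0.
Proof. by rewrite /iK /ofR; case: k => /=; rewrite ?mul0r// mulr0 subr0. Qed.

Lemma imKD (a b : K) : imK (a + b) = imK a + imK b.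
Proof. by rewrite /imK; case: k a b => [|[? ?] [? ?]] //=; rewrite addr0. Qed.

Lemma imK_le (a : K) : `|imK a| <= rnorm a.
Proof.
rewrite -(ofR_le k) rnormE /imK; case: k a => /= [a|a].
  by rewrite normr0 normr_ge0.
rewrite normc_def lecR -sqrtr_sqr ler_sqrt ?lerDr ?sqr_ge0//.
by rewrite addr_ge0 ?sqr_ge0.
Qed.

Lemma scalarE (a : K) : a = ofR (reK a) + iK * ofR (imK a).
Proof.
rewrite /ofR /reK /iK /imK; case: k a => [a|a]; first by rewrite mul0r addr0.
exact: complexE.
Qed.

Lemma rnorm1 : rnorm (1 : K) = 1.
Proof. by rewrite /rnorm normr1 -(ofR1 R k) ofRK. Qed.

Lemma rnorm_ofRE (r : R) : rnorm (ofR r : K) = `|r|.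
Proof.
have [r0|r0] := leP 0 r; first by rewrite rnorm_ofR// ger0_norm.
rewrite -rnormN (_ : - ofR r = ofR (- r) :> K).
  by rewrite rnorm_ofR ?ltr0_norm ?oppr_ge0 ?ltW.
by rewrite /ofR; case: k => //=; rewrite rmorphN.
Qed.

Lemma rnormM (a b : K) : rnorm (a * b) = rnorm a * rnorm b.
Proof. exact: (rnormZ (V := K^o)). Qed.

Lemma rnorm_iK : rnorm iK <= 1.
Proof.
rewrite rnorm_le ofR1 /iK; case: k => /=; first by rewrite normr0.
by rewrite normc_def /= expr0n /= add0r expr1n sqrtr1.
Qed.

Lemma rnorm_le_reim (a : K) : rnorm a <= `|reK a| + `|imK a|.
Proof.
rewrite {1}[a]scalarE (le_trans (rnormD _ _))// rnorm_ofRE lerD2l.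
by rewrite rnormM rnorm_ofRE ler_piMl// rnorm_iK.
Qed.

Lemma ofRN (r : R) : ofR (- r) = - ofR r :> K.
Proof. by rewrite /ofR; case: k => //=; rewrite rmorphN. Qed.

Lemma ofRB (r s : R) : ofR (r - s) = ofR r - ofR s :> K.
Proof. by rewrite ofRD ofRN. Qed.

Lemma reKB (a b : K) : reK (a - b) = reK a - reK b.
Proof. by case: k a b => //= -[? ?] [? ?]. Qed.

Lemma imKB (a b : K) : imK (a - b) = imK a - imK b.
Proof. by rewrite /imK; case: k a b => [|[? ?] [? ?]] //=; rewrite subr0. Qed.

Lemma ofR_lt (x y : R) : (ofR x < ofR y :> K) = (x < y).
Proof.
by rewrite !lt_neqAle ofR_le (inj_eq (can_inj (@ofRK R k))).
Qed.

Lemma rnorm_lt (V : normedZmodType K) (x : V) (c : R) :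
  (rnorm x < c) = (`|x| < ofR c).
Proof. by rewrite -rnormE ofR_lt. Qed.

Lemma scalar_gt0_ofR (e : K) : 0 < e -> 0 < reK e /\ ofR (reK e) = e.
Proof. by move=> e0; rewrite -(ofR_lt) reKK ?ltW// ofR0. Qed.

Lemma rnormB (V : normedZmodType K) (x y : V) : rnorm (x - y) = rnorm (y - x).
Proof. by rewrite -rnormN opprB. Qed.

Lemma rnorm_sum (V : normedZmodType K) I (r : seq I) (P : pred I) (F : I -> V) :
  rnorm (\sum_(i <- r | P i) F i) <= \sum_(i <- r | P i) rnorm (F i).
Proof.
elim/big_ind2 : _ => //; first by rewrite rnorm0.
by move=> x1 x2 y1 y2 h1 h2; rewrite (le_trans (rnormD _ _))// lerD.
Qed.

Lemma rnorm_eq0 (V : normedZmodType K) (x : V) : (rnorm x == 0) = (x == 0).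
Proof.
by apply/eqP/eqP => [/rnorm0_eq0//|->]; rewrite rnorm0.
Qed.

Lemma rnorm_gt0 (V : normedZmodType K) (x : V) : (0 < rnorm x) = (x != 0).
Proof. by rewrite lt_neqAle rnorm_ge0 andbT eq_sym rnorm_eq0. Qed.

(** Convergence in a normed space, with radii in [R] instead of [K]. *)
Lemma cvg_rnormP (V : normedModType K) T (F : set_system T) (FF : Filter F)
    (u : T -> V) (l : V) :
  (u @ F --> l) <->
  (forall e : R, 0 < e -> \forall x \near F, rnorm (l - u x) < e).
Proof.
split=> [/cvgrPdist_lt h e e0|h].
  have := h (ofR e); rewrite -(ofR0 R k) ofR_lt => /(_ e0).
  by apply: filterS => x; rewrite rnorm_lt.
apply/cvgrPdist_lt => e /scalar_gt0_ofR[e0 eE].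
by apply: filterS (h _ e0) => x; rewrite rnorm_lt eE.
Qed.

Lemma cvg_seq_rnormP (V : normedModType K) (u : nat -> V) (l : V) :
  (u @ \oo --> l) <->
  (forall e : R, 0 < e ->
    exists N, forall n, (N <= n)%N -> rnorm (l - u n) < e).
Proof.
split=> [/cvg_rnormP h e /h[N _ NP]|h]; first by exists N => n; exact: NP.
by apply/cvg_rnormP => e /h[N NP]; exists N.
Qed.

(** Completeness, in terms of real radii: unlike [completeNormedModType] it is
    a property, which passes to spaces of operators. *)
Definition cauchy_complete (V : normedModType K) : Prop := forall u : nat -> V,
  (forall e : R, 0 < e -> exists N, forall n l, (N <= n)%N -> (N <= l)%N ->
    rnorm (u n - u l) <= e) -> exists v : V, u @ \oo --> v.

Lemma real_cauchy_cvg (u : nat -> R) :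
  (forall e : R, 0 < e -> exists N, forall n l, (N <= n)%N -> (N <= l)%N ->
    `|u n - u l| <= e) -> exists v : R, u @ \oo --> v.
Proof.
move=> h; suff /cvg_ex[v uv] : cvg (u @ \oo) by exists v.
apply/cauchy_cvgP/cauchy_exP => e e0.
have [N NP] : exists N, forall n l, (N <= n)%N -> (N <= l)%N ->
    `|u n - u l| <= e / 2 by apply: h; rewrite divr_gt0.
exists (u N), N => // n /= Nn; rewrite /ball/=.
by rewrite (le_lt_trans (NP _ _ _ _))// ltr_pdivrMr// mulr_natr mulr2n ltrDl.
Qed.

Lemma scalar_cauchy_complete : cauchy_complete (K^o).
Proof.
move=> u uc.
have [a ua] : exists a : R, (fun n => reK (u n)) @ \oo --> a.
  apply: real_cauchy_cvg => e /uc[N NP]; exists N => n l Nn Nl.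
  by rewrite -reKB (le_trans (reK_le _))// NP.
have [b ub] : exists b : R, (fun n => imK (u n)) @ \oo --> b.
  apply: real_cauchy_cvg => e /uc[N NP]; exists N => n l Nn Nl.
  by rewrite -imKB (le_trans (imK_le _))// NP.
exists (ofR a + iK * ofR b : K); apply/cvg_rnormP => e e0.
have e2 : 0 < e / 2 by rewrite divr_gt0.
move/cvgrPdist_lt : ua => /(_ _ e2) ua; move/cvgrPdist_lt : ub => /(_ _ e2) ub.
near=> n; rewrite [u n]scalarE opprD addrACA -mulrBr -!ofRB.
rewrite (le_lt_trans (rnormD _ _))// [e]splitr ltrD//.
  by rewrite rnorm_ofRE; near: n.
rewrite rnormM rnorm_ofRE (le_lt_trans (ler_piMl _ rnorm_iK))//.
by near: n.
Unshelve. all: by end_near. Qed.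

(** The rationals, or the complex numbers with rational coordinates. *)
Lemma scalar_separable : exists d : nat -> K,
  forall a (e : R), 0 < e -> exists j, rnorm (a - d j) < e.
Proof.
pose c (n : nat) : R * R :=
  if (unpickle n : option (rat * rat)) is Some q then (ratr q.1, ratr q.2)
  else (0, 0).
exists (fun n => ofR (c n).1 + iK * ofR (c n).2) => a e e0.
have rat_near (r : R) : exists q : rat, `|r - ratr q| < e / 2.
  have /rat_in_itvoo[q] : r < r + e / 2 by rewrite ltrDl divr_gt0.
  rewrite in_itv/= => /andP[rq qr]; exists q.
  by rewrite distrC gtr0_norm ?subr_gt0// ltrBlDl.
have [q1 q1P] := rat_near (reK a); have [q2 q2P] := rat_near (imK a).
exists (pickle (q1, q2)); rewrite /c pickleK /= {1}[a]scalarE.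
rewrite opprD addrACA -mulrBr -!ofRB (le_lt_trans (rnormD _ _))//.
rewrite [e]splitr ltrD// ?rnorm_ofRE// rnormM rnorm_ofRE.
by rewrite (le_lt_trans (ler_piMl _ rnorm_iK)).
Qed.

(** Of the four sums of the positive and of the negative parts of the real
    and of the imaginary parts of the [c i], one is at least a quarter of the
    sum of the moduli. *)
Lemma subset_sum_ge (I : finType) (c : I -> K) :
  exists S : pred I, \sum_i rnorm (c i) <= 4 * rnorm (\sum_(i | S i) c i).
Proof.
have re_sum (S : pred I) :
    reK (\sum_(i | S i) c i) = \sum_(i | S i) reK (c i).
  apply: (big_morph (reK : K -> R)); first exact: reKD.
  by rewrite -(ofR0 R k) ofRK.
have im_sum (S : pred I) :
    imK (\sum_(i | S i) c i) = \sum_(i | S i) imK (c i).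
  apply: (big_morph (imK : K -> R)); first exact: imKD.
  by rewrite /imK; case: k.
have sum_abs (f : I -> R) : \sum_i `|f i| =
    `|\sum_(i | 0 <= f i) f i| + `|\sum_(i | ~~ (0 <= f i)) f i|.
  rewrite (bigID (fun i => 0 <= f i))/=; congr (_ + _).
    by rewrite ger0_norm ?sumr_ge0//; apply: eq_bigr => i /ger0_norm.
  rewrite ler0_norm; last by apply: sumr_le0 => i; rewrite -ltNge => /ltW.
  by rewrite -sumrN; apply: eq_bigr => i; rewrite -ltNge => /ltr0_norm.
apply: contrapT => /forallNP h.
have small (S : pred I) :
    4 * rnorm (\sum_(i | S i) c i) < \sum_i rnorm (c i).
  by rewrite ltNge; apply/negP/h.
have h1 : \sum_i rnorm (c i) <= \sum_i `|reK (c i)| + \sum_i `|imK (c i)|.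
  by rewrite -big_split; apply: ler_sum => i _; exact: rnorm_le_reim.
rewrite !sum_abs -!re_sum -!im_sum in h1.
have s1 := small (fun i => 0 <= reK (c i)).
have s2 := small (fun i => ~~ (0 <= reK (c i))).
have s3 := small (fun i => 0 <= imK (c i)).
have s4 := small (fun i => ~~ (0 <= imK (c i))).
have := reK_le (\sum_(i | 0 <= reK (c i)) c i).
have := reK_le (\sum_(i | ~~ (0 <= reK (c i))) c i).
have := imK_le (\sum_(i | 0 <= imK (c i)) c i).
have := imK_le (\sum_(i | ~~ (0 <= imK (c i))) c i).
lra.
Qed.

End scalar_facts.
Arguments iK {R k}.
Arguments imK {R k}.

(** * The Hahn-Banach theorem *)

Section hahn_banach.
Variables (R : realType) (k : scalar_kind).
Local Notation K := (scalars R k).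
Variable Z : normedModType K.
Implicit Types (p q : Z -> R) (x y z : Z) (t : R).

Definition sublinear p : Prop :=
  (forall x y, p (x + y) <= p x + p y) /\
  (forall t x, 0 < t -> p (ofR t *: x) <= t * p x).

Lemma sublinear0 p : sublinear p -> p 0 = 0.
Proof.
move=> [_ pZ].
have := pZ 2 0; have := pZ 2^-1 0.
by rewrite !scaler0 invr_gt0 ltr0n => /(_ isT) + /(_ isT); lra.
Qed.

Lemma sublinearZ p t x : sublinear p -> 0 <= t -> p (ofR t *: x) = t * p x.
Proof.
move=> sp; rewrite le_eqVlt => /predU1P[<-|t0].
  by rewrite ofR0 scale0r mul0r sublinear0.
have [_ pZ] := sp; apply/eqP; rewrite eq_le pZ//=.
rewrite -ler_pdivlMl//; have := pZ t^-1 (ofR t *: x).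
by rewrite invr_gt0 t0 scalerA -ofRM mulVf ?gt_eqF// ofR1 scale1r; exact.
Qed.

Lemma sublinear_ge p x : sublinear p -> - p (- x) <= p x.
Proof.
move=> sp; have [pD _] := sp.
by have := pD x (- x); rewrite subrr (sublinear0 sp) -lerBlDr sub0r.
Qed.

(** The largest sublinear functional below [p] whose value at [- y] is at most
    [- p y]. *)
Definition reduce p y x : R :=
  inf [set p (x + ofR t *: y) - t * p y | t in [set t | 0 <= t]].

Lemma reduce_has_inf p y x : sublinear p ->
  has_inf [set p (x + ofR t *: y) - t * p y | t in [set t | 0 <= t]].
Proof.
move=> sp; split; first by eexists; exists 0 => /=.
exists (- p (- x)) => _ [t /= t0 <-]; rewrite -(sublinearZ _ sp t0).
rewrite lerBrDr addrC lerBlDr.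
by have [pD _] := sp; rewrite (le_trans _ (pD _ _))// addrAC subrr add0r.
Qed.

Lemma reduce_le p y x t : sublinear p -> 0 <= t ->
  reduce p y x <= p (x + ofR t *: y) - t * p y.
Proof.
by move=> sp t0; apply: ge_inf; [have [] := reduce_has_inf y x sp|exists t].
Qed.

Lemma reduce_le_id p y x : sublinear p -> reduce p y x <= p x.
Proof.
by move=> sp; have := reduce_le y x sp (lexx 0);
  rewrite ofR0 scale0r addr0 mul0r subr0.
Qed.

Lemma reduce_sublinear p y : sublinear p -> sublinear (reduce p y).
Proof.
move=> sp; have [pD pZ] := sp; split.
  move=> x x'; rewrite -lerBlDr; apply: lb_le_inf.
    by have [] := reduce_has_inf y x sp.
  move=> _ [t /= t0 <-]; rewrite lerBlDr -lerBlDl; apply: lb_le_inf.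
    by have [] := reduce_has_inf y x' sp.
  move=> _ [t' /= t'0 <-]; rewrite lerBlDl.
  rewrite (le_trans (reduce_le _ _ sp (addr_ge0 t0 t'0)))//.
  rewrite ofRD scalerDl addrACA mulrDl opprD.
  by have := pD (x + ofR t *: y) (x' + ofR t' *: y); lra.
move=> t x t0; rewrite -ler_pdivrMl//; apply: lb_le_inf.
  by have [] := reduce_has_inf y x sp.
move=> _ [s /= s0 <-]; rewrite ler_pdivrMl//.
rewrite (le_trans (reduce_le _ _ sp (mulr_ge0 (ltW t0) s0)))//.
by rewrite ofRM -scalerA -scalerDr mulrBr mulrA lerD2r pZ.
Qed.

(** Zorn's lemma provides a minimal sublinear functional [p] below [q], which
    coincides with all its reductions: [p x <= p (x + y) - p y] for all [x] and
    [y], so that [p] is additive. *)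
Lemma sublinear_minorant q : sublinear q -> exists u : Z -> R,
  [/\ forall x y, u (x + y) = u x + u y, forall t x, u (ofR t *: x) = t * u x
    & forall x, u x <= q x].
Proof.
move=> sq.
pose below p := sublinear p /\ forall x, p x <= q x.
pose S := {p : Z -> R | below p}.
pose r (s s' : S) := `[< forall x, sval s' x <= sval s x >].
have q0 : S by exists q.
have [| | |[p [sp pq]] pmin] := @ZL_preorder S q0 r.
- by move=> s; apply/asboolP.
- move=> s1 s2 s3 /asboolP h1 /asboolP h2; apply/asboolP => x.
  exact: le_trans (h2 x) (h1 x).
- move=> A Atot; have [->|/set0P[s0 As0]] := eqVneq A set0.
    by exists q0.
  pose F x := [set sval s x | s in A].
  have Fi x : has_inf (F x).
    split; first by exists (sval s0 x), s0.
    exists (- q (- x)) => _ [[p [sp pq]] /= _ <-].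
    by rewrite (le_trans _ (sublinear_ge x sp))// lerN2.
  have F_le s x : A s -> inf (F x) <= sval s x.
    by move=> As; apply: ge_inf; [have [] := Fi x|exists s].
  have si : sublinear (fun x => inf (F x)) /\ forall x, inf (F x) <= q x.
    split; last first.
      by move=> x; rewrite (le_trans (F_le _ x As0))//; case: (s0) => p [].
    split.
      move=> x y; rewrite -lerBlDr; apply: lb_le_inf; first by have [] := Fi x.
      move=> _ [s As <-]; rewrite lerBlDr -lerBlDl.
      apply: lb_le_inf; first by have [] := Fi y.
      move=> _ [s' As' <-]; rewrite lerBlDl.
      have [/asboolP h|/asboolP h] := Atot _ _ As As'.
        rewrite (le_trans (F_le _ _ As'))//.
        case: s' {As'} h => p' [[p'D _] _] /= h.
        by rewrite (le_trans (p'D _ _))// lerD2r.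
      rewrite (le_trans (F_le _ _ As))//.
      case: s {As} h => p' [[p'D _] _] /= h.
      by rewrite (le_trans (p'D _ _))// lerD2l.
    move=> t x t0; rewrite -ler_pdivrMl//.
    apply: lb_le_inf; first by have [] := Fi x.
    move=> _ [s As <-]; rewrite ler_pdivrMl// (le_trans (F_le _ _ As))//.
    by case: s {As} => p [[_ pZ] _] /=; exact: pZ.
  exists (@exist _ below _ si) => s As; apply/asboolP => x /=; exact: F_le.
have pD x y : p (x + y) = p x + p y.
  have [pD _] := sp; apply/eqP; rewrite eq_le pD/=.
  have rq : sublinear (reduce p y) /\ forall x, reduce p y x <= q x.
    split; first exact: reduce_sublinear.
    by move=> z; rewrite (le_trans (reduce_le_id _ _ sp)).
  have /asboolP := pmin (@exist _ below _ rq) (introT (asboolP _)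
    (fun z => reduce_le_id y z sp)).
  move=> /(_ x)/= /le_trans -/(_ _ (reduce_le y x sp ler01)).
  by rewrite ofR1 scale1r mul1r -lerBrDr.
have pN x : p (- x) = - p x.
  by apply/eqP; rewrite -subr_eq0 opprK -pD addNr (sublinear0 sp).
exists p; split=> // t x.
have [t0|t0] := leP 0 t; first exact: sublinearZ.
by rewrite -{1}[t]opprK ofRN scaleNr pN sublinearZ ?oppr_ge0 ?ltW// mulNr opprK.
Qed.

(** A real functional [u] dominated by the seminorm [q] is the real part of the
    functional [x |-> u x - i (u (i x))], whose modulus is at most [q] because
    [x] may be replaced by its product with a scalar of modulus [1]. *)
Lemma seminorm_functional (q : Z -> R) (z : Z) :
  (forall x y, q (x + y) <= q x + q y) ->
  (forall (a : K) x, q (a *: x) <= rnorm a * q x) ->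
  (exists M, forall x, q x <= M * rnorm x) ->
  exists w : dual Z, (forall x, rnorm (w x) <= q x) /\ q z <= rnorm (w z).
Proof.
move=> qD qZ [M qM].
have sq : sublinear q.
  by split=> // t x t0; rewrite (le_trans (qZ _ _))// (rnorm_ofR _ (ltW t0)).
(* A minorant of the reduction at [z] has the value [q z] at [z]. *)
have [u [uD uZ ur]] := sublinear_minorant (reduce_sublinear z sq).
have uq x : u x <= q x := le_trans (ur x) (reduce_le_id z x sq).
have uN x : u (- x) = - u x by rewrite -scaleN1r -(ofR1 R k) -ofRN uZ mulN1r.
have qN x : q (- x) <= q x.
  by rewrite -scaleN1r (le_trans (qZ _ _))// rnormN rnorm1 mul1r.
have uz : q z <= u z.
  have := le_trans (ur (- z)) (reduce_le z (- z) sq ler01).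
  by rewrite ofR1 scale1r mul1r addNr (sublinear0 sq) sub0r uN lerN2.
pose f x : K := ofR (u x) - iK * ofR (u (iK *: x)).
have fD x y : f (x + y) = f x + f y.
  by rewrite /f scalerDr !uD !ofRD mulrDr opprD addrACA.
have f_re t x : f (ofR t *: x) = ofR t * f x.
  rewrite /f scalerA [iK * ofR t]mulrC -scalerA !uZ !ofRM mulrBr.
  by rewrite [iK * (_ * _)]mulrCA.
have f_i x : f (iK *: x) = iK * f x.
  have [i0|ii] := iK_cases R k.
    rewrite /f i0 !mul0r scale0r subr0 -(ofR0 R k); congr ofR.
    by rewrite -(scale0r (0 : Z)) -(ofR0 R k) uZ mul0r.
  rewrite /f mulrBr mulrA scalerA ii mulN1r scaleN1r uN ofRN mulrN !opprK.
  by rewrite addrC.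
have fE a x : f (a *: x) = a * f x.
  rewrite {1}[a]scalarE scalerDl fD -scalerA f_i !f_re [in RHS](scalarE a).
  by rewrite mulrDl mulrA.
have re_f x : reK (f x) = u x by rewrite /f reKB ofRK reK_iKM subr0.
have fq x : rnorm (f x) <= q x.
  have [->|fx0] := eqVneq (f x) 0.
    rewrite rnorm0; have := qD x (- x); rewrite subrr.
    by have := qN x; rewrite (sublinear0 sq); lra.
  (* [c] rotates [f x] to its modulus. *)
  pose c : K := ofR (rnorm (f x)) / f x.
  have nc : rnorm c = 1.
    rewrite /c rnormM rnormV rnorm_ofR ?rnorm_ge0// divff//.
    by rewrite rnorm_eq0.
  have <- : u (c *: x) = rnorm (f x).
    by rewrite -re_f fE /c divfK// ofRK.
  by rewrite (le_trans (uq _))// (le_trans (qZ _ _))// nc mul1r.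
have fl : bounded_linear (f : Z -> K^o).
  split; first by move=> a x y; rewrite fD fE.
  by exists M => x; rewrite (le_trans (fq x)).
exists (mkbop fl); split; first exact: fq.
by rewrite (le_trans uz)// -re_f (le_trans (ler_norm _))// reK_le.
Qed.

Lemma norming_functional (z : Z) : exists w : dual Z,
  (forall x, rnorm (w x) <= rnorm x) /\ rnorm z <= rnorm (w z).
Proof.
apply: seminorm_functional; [exact: rnormD| |exists 1 => x].
  by move=> a x; rewrite rnormZ.
by rewrite mul1r.
Qed.

Lemma canonical_embedding_inj : injective (canonical_embedding Z).
Proof.
move=> z z' zz'; apply/eqP; rewrite -subr_eq0; apply/eqP/rnorm0_eq0/eqP.
rewrite eq_le rnorm_ge0 andbT.
have [w [_ /le_trans]] := norming_functional (z - z'); apply.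
rewrite -scaleN1r bopD bopZ scaleN1r.
rewrite (_ : w z = canonical_embedding Z z w)// zz' subrr rnorm0.
by [].
Qed.

End hahn_banach.

(** * Semivariation of finitely additive measures *)

Section borel_sets.
Variable Omega : topologicalType.
Implicit Types E F : set Omega.

Lemma borel0 : borel (set0 : set Omega).
Proof.
have [h _ _] := smallest_sigma_algebra [set: Omega] open.
exact: h.
Qed.

Lemma borelC E : borel E -> borel (~` E).
Proof.
have [_ h _] := smallest_sigma_algebra [set: Omega] open.
by move=> /h; rewrite setTD.
Qed.

Lemma borelT : borel [set: Omega].
Proof. by rewrite -setC0; apply: borelC; exact: borel0. Qed.

Lemma borel_open E : open E -> borel E.
Proof. by move=> oE; exact: (@sub_sigma_algebra _ _ open). Qed.

Lemma borel_closed E : closed E -> borel E.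
Proof.
move=> cE; rewrite -[E]setCK; apply: borelC; apply: borel_open.
exact: closed_openC.
Qed.

Lemma borel_bigcup (A : nat -> set Omega) (P : set nat) :
  (forall i, P i -> borel (A i)) -> borel (\bigcup_(i in P) A i).
Proof.
move=> bA; rewrite bigcup_mkcond.
have [_ _] := smallest_sigma_algebra [set: Omega] open; apply => i.
by case: ifPn => [|_]; [rewrite inE; exact: bA|exact: borel0].
Qed.

Lemma borelU E F : borel E -> borel F -> borel (E `|` F).
Proof.
move=> bE bF; rewrite -bigcup2E; apply: borel_bigcup => -[|[|i]] _ //=.
exact: borel0.
Qed.

Lemma borelI E F : borel E -> borel F -> borel (E `&` F).
Proof.
move=> bE bF; rewrite -[X in borel X]setCK setCI; apply: borelC.
by apply: borelU; exact: borelC.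
Qed.

Lemma borelD E F : borel E -> borel F -> borel (E `\` F).
Proof. by move=> bE bF; rewrite setDE; apply: borelI => //; exact: borelC. Qed.

End borel_sets.

Section semivariation.
Variables (R : realType) (k : scalar_kind) (Omega : topologicalType).
Local Notation K := (scalars R k).
Variable Z : normedModType K.
Implicit Types (m : set Omega -> Z) (E F : set Omega) (S : R).

Lemma finitely_additive0 m : finitely_additive m -> m set0 = 0.
Proof.
move=> fm; apply: (addrI (m set0)); rewrite addr0 -fm ?set0U ?set0I//;
  exact: borel0.
Qed.

Lemma finitely_additive_cover m (I : finType) (A : I -> set Omega) E :
  finitely_additive m -> (forall i, borel (A i)) -> trivIset setT A ->
  borel E -> E `<=` \bigcup_i A i -> m E = \sum_i m (E `&` A i).
Proof.
move=> fm bA tA bE EA.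
suff h (r : seq I) : uniq r ->
    borel (E `&` \bigcup_(i in [set` r]) A i) /\
    m (E `&` \bigcup_(i in [set` r]) A i) = \sum_(i <- r) m (E `&` A i).
  have [_ <-] := h _ (index_enum_uniq I); congr m; apply/seteqP; split=> w //=.
    by move=> Ew; split=> //; have [i _ Aw] := EA w Ew; exists i => //=;
      rewrite mem_index_enum.
  by case.
elim: r => [_|i r ih /=].
  rewrite big_nil set_nil bigcup_set0 setI0; split; first exact: borel0.
  exact: finitely_additive0.
move=> /andP[ir ur]; have [b mE] := ih ur.
have -> : E `&` \bigcup_(j in [set` i :: r]) A j =
    (E `&` A i) `|` (E `&` \bigcup_(j in [set` r]) A j).
  apply/seteqP; split=> w /=.
    move=> [Ew [j /= + Aw]]; rewrite inE => /orP[/eqP <-|jr]; first by left.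
    by right; split=> //; exists j.
  move=> [[Ew Aw]|[Ew [j /= jr Aw]]]; split=> //.
    by exists i => //=; rewrite mem_head.
  by exists j => //=; rewrite inE jr orbT.
have bi : borel (E `&` A i) by apply: borelI.
split; first exact: borelU.
rewrite fm//; last first.
  rewrite -subset0 => w [[_ Aiw] [_ [j /= jr Ajw]]].
  have ij : i = j by apply: tA => //; exists w.
  by rewrite ij jr in ir.
by rewrite mE big_cons.
Qed.

(** Real bounds keep the estimates below out of extended arithmetic. *)
Definition semivar_le m F S : Prop := (semivariation m F <= S%:E)%E.

(** The sets [A i] are indexed by any finite type and need not cover [F]: the
    rest of [F], with the coefficient [0], completes them to a partition. *)
Lemma semivar_leP m F S : borel F -> finitely_additive m -> semivar_le m F S <->
  forall (I : finType) (A : I -> set Omega) (e : I -> K),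
    (forall i, borel (A i)) -> trivIset setT A -> (forall i, A i `<=` F) ->
    (forall i, rnorm (e i) <= 1) -> rnorm (\sum_i e i *: m (A i)) <= S.
Proof.
move=> bF fm; split=> [mS I A e bA tA AF e1|h].
  rewrite -lee_fin (le_trans _ mS)//; apply: ereal_sup_ubound.
  pose A' (o : option I) := if o is Some i then A i else F `\` \bigcup_i A i.
  pose e' (o : option I) := if o is Some i then e i else 0.
  exists #|{: option I}|, (A' \o enum_val), (e' \o enum_val); split.
  - move=> n /=; case: (enum_val n) => [i|]; first exact: bA.
    apply: borelD => //.
    rewrite (_ : \bigcup_i A i = \big[setU/set0]_i A i).
      elim/big_ind : _ => [|? ? ? ?|i _]; [exact: borel0|exact: borelU|].
      exact: bA.
    by rewrite -(bigcup_pred predT); apply: eq_bigcupl; split=> i.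
  - move=> n n' _ _ [w /= []].
    case En : (enum_val n) => [i|]; case En' : (enum_val n') => [i'|].
    + move=> Aw Aw'; apply: enum_val_inj; rewrite En En'; congr Some.
      by apply: tA => //; exists w.
    + by move=> Aw [_ []]; exists i.
    + by move=> [_ +] Aw; case; exists i'.
    + by move=> _ _; apply: enum_val_inj; rewrite En En'.
  - apply/seteqP; split=> w.
      by move=> [n _] /=; case: (enum_val n) => [i|[]//]; exact: AF.
    move=> Fw; have [[i _ Aw]|nA] := pselect ((\bigcup_i A i) w).
      by exists (enum_rank (Some i)) => //=; rewrite enum_rankK.
    by exists (enum_rank None) => //=; rewrite enum_rankK.
  - move=> n /=; case: (enum_val n) => [i|]; first exact: e1.
    by rewrite rnorm0.
  - apply: (congr1 (fun z => (rnorm z)%:E)).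
    rewrite [RHS](reindex_onto enum_rank enum_val) => [|n _]; last first.
      exact: enum_valK.
    rewrite (eq_bigl xpredT) => [|o]; last by rewrite enum_rankK eqxx.
    rewrite (bigD1 None)//= enum_rankK scale0r add0r.
    rewrite (reindex_omap Some id) => [|[]//].
    by apply: eq_big => [i|i _]; rewrite ?eqxx ?enum_rankK.
apply: ge_ereal_sup => _ [n [A [e [bA tA AF e1 ->]]]].
by rewrite lee_fin h// => i w Aw; rewrite -AF; exists i.
Qed.

Lemma semivar_le_ge0 m F S : borel F -> finitely_additive m ->
  semivar_le m F S -> 0 <= S.
Proof.
move=> bF fm /(semivar_leP _ bF fm).
move=> /(_ void (fun=> set0) (fun=> 0)) h.
by rewrite (le_trans _ (h _ _ _ _))// ?rnorm_ge0//; case.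
Qed.

Lemma semivar_le_sum m F S c (I : finType) (A : I -> set Omega) (e : I -> K) :
  borel F -> finitely_additive m -> semivar_le m F S ->
  (forall i, borel (A i)) -> trivIset setT A -> (forall i, A i `<=` F) ->
  0 <= c -> (forall i w, A i w -> rnorm (e i) <= c) ->
  rnorm (\sum_i e i *: m (A i)) <= c * S.
Proof.
move=> bF fm mS bA tA AF c0 ec.
have ec' i : m (A i) != 0 -> rnorm (e i) <= c.
  have [->|/set0P[w Aw] _] := eqVneq (A i) set0; last exact: ec Aw.
  by rewrite finitely_additive0// eqxx.
have [c_eq0|cn0] := eqVneq c 0.
  rewrite c_eq0 mul0r big1 ?rnorm0// => i _.
  have [->|/ec'] := eqVneq (m (A i)) 0; first by rewrite scaler0.
  rewrite c_eq0 => ei; rewrite (_ : e i = 0) ?scale0r//.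
  by apply: rnorm0_eq0; apply/eqP; rewrite eq_le ei rnorm_ge0.
have cp : 0 < c by rewrite lt_neqAle eq_sym cn0.
pose e' i := if m (A i) == 0 then 0 else ofR c^-1 * e i.
have -> : \sum_i e i *: m (A i) = ofR c *: \sum_i e' i *: m (A i).
  rewrite scaler_sumr; apply: eq_bigr => i _; rewrite /e'.
  have [->|_] := eqVneq (m (A i)) 0; first by rewrite !scaler0.
  by rewrite scalerA mulrA -ofRM divff// ofR1 mul1r.
rewrite rnormZ rnorm_ofR// ler_wpM2l//.
move/(semivar_leP _ bF fm) : mS; apply => // i; rewrite /e'.
have [_|/ec' ei] := eqVneq (m (A i)) 0; first by rewrite rnorm0.
by rewrite rnormM rnorm_ofR ?invr_ge0// mulrC ler_pdivrMr// mul1r.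
Qed.

Lemma semivar_le_norm m F E S : borel F -> borel E -> finitely_additive m ->
  semivar_le m F S -> E `<=` F -> rnorm (m E) <= S.
Proof.
move=> bF bE fm mS EF; rewrite -[m E]scale1r -[S]mul1r.
have := @semivar_le_sum m F S 1 'I_1 (fun=> E) (fun=> 1) bF fm mS.
rewrite big_ord1; apply => //; last by move=> _ w _; rewrite rnorm1.
by move=> i j _ _ _; rewrite (ord1 i) (ord1 j).
Qed.

Lemma semivar_le_sub m F E S : borel F -> borel E -> finitely_additive m ->
  semivar_le m F S -> E `<=` F -> semivar_le m E S.
Proof.
move=> bF bE fm /(semivar_leP _ bF fm) h EF.
apply/semivar_leP => // I A e bA tA AE.
by apply: h => // i; apply: subset_trans EF; exact: AE.
Qed.

Lemma semivar_leU m E F S S' : borel E -> borel F -> finitely_additive m ->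
  semivar_le m E S -> semivar_le m F S' -> semivar_le m (E `|` F) (S + S').
Proof.
move=> bE bF fm /(semivar_leP _ bE fm) mE /(semivar_leP _ bF fm) mF.
apply/semivar_leP => //; first exact: borelU.
move=> I A e bA tA AEF e1.
have mAE i : m (A i) = m (A i `&` E) + m (A i `\` E).
  rewrite -fm; first by rewrite setDE -setIUr setUv setIT.
  - exact: borelI.
  - exact: borelD.
  - by rewrite setDE setIACA setICr setI0.
under eq_bigr do rewrite mAE scalerDr.
rewrite big_split (le_trans (rnormD _ _))//= lerD//.
  apply: (mE _ _ e) => // [i|i j _ _ [w [[? _] [? _]]]].
  - exact: borelI.
  - by apply: tA => //; exists w.
apply: (mF _ _ e) => // [i|i j _ _ [w [[? _] [? _]]]|i w [/AEF[]]//].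
- exact: borelD.
- by apply: tA => //; exists w.
Qed.

Lemma bounded_measure_semivar m :
  bounded_measure m -> exists S, semivar_le m setT S.
Proof.
rewrite /bounded_measure /semivar_le.
case: (semivariation m setT) => // [S _|_]; first by exists S.
by exists 0; rewrite leNye.
Qed.

Lemma eq_regular_measure m m' : (forall E, borel E -> m E = m' E) ->
  regular_measure m -> regular_measure m'.
Proof.
move=> mm' rm E e bE e0; have [C [U [cC oU CE EU mUC]]] := rm E e bE e0.
exists C, U; split=> //; apply: le_lt_trans mUC.
apply: ge_ereal_sup => _ [n [A [a [bA tA AF a1 ->]]]]; apply: ereal_sup_ubound.
exists n, A, a; split=> //; apply: (congr1 (fun z => (rnorm z)%:E)).
by apply: eq_bigr => i _; rewrite mm'.
Qed.

End semivariation.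

(** * Integrals of continuous functions *)

Section step_integral.
Variables (R : realType) (k : scalar_kind) (Omega : topologicalType).
Local Notation K := (scalars R k).
Variable Z : normedModType K.
Implicit Types (m : set Omega -> Z) (E F : set Omega) (s : Omega -> K).

(** [z] is the integral of [s] computed from some finite Borel partition on
    whose pieces [s] is constant: the pieces need not be the level sets, so that
    a common refinement can be used for two functions. *)
Definition step_integral m s (z : Z) : Prop :=
  exists (I : finType) (a : I -> K) (A : I -> set Omega),
    [/\ forall i, borel (A i), trivIset setT A, \bigcup_i A i = setT,
        forall i w, A i w -> s w = a i & z = \sum_i a i *: m (A i)].

Lemma simple_step_integral m s :
  simple_fun s -> step_integral m s (simple_fun_integral m s).
Proof.
move=> [fs bs]; set r : seq K := finmap.enum_fset (fset_set (range s)).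
have rP a : (a \in r) = (a \in range s) by rewrite -in_fset_set.
have ur : uniq r by exact: finmap.fset_uniq.
exists 'I_(size r), (tnth (in_tuple r)),
  (fun i => s @^-1` [set tnth (in_tuple r) i]).
split=> //.
- move=> i j _ _ [w [/= -> /eqP]]; rewrite !(tnth_nth 0)/= nth_uniq//.
  by move=> /eqP/val_inj.
- apply/seteqP; split=> // w _.
  have /(nthP 0)[n nr swE] : s w \in r by rewrite rP inE; exists w.
  by exists (Ordinal nr) => //=; rewrite (tnth_nth 0)/= swE.
- by rewrite /simple_fun_integral fsbig_finite// -/r big_tnth.
Qed.

Lemma indic_step_integral m E : finitely_additive m -> borel E ->
  step_integral m (\1_E) (m E).
Proof.
move=> fm bE; exists bool, (fun b : bool => b%:R),
  (fun b : bool => if b then E else ~` E); split.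
- by case=> //; exact: borelC.
- by case=> -[]// _ _ [w []].
- apply/seteqP; split=> // w _.
  by have [Ew|Ew] := pselect (E w); [exists true|exists false].
- case=> w; rewrite indicE => Ew; congr _%:R; first by rewrite mem_set.
  by rewrite memNset.
- by rewrite big_bool/= scale1r mulr0n scale0r addr0.
Qed.

(** The coefficients of [s - s'] on the common refinement are bounded by [c] on
    the pieces of [F] and by [d] on the other pieces. *)
Lemma step_integral_sub m s s' z z' F (S S' c d : R) : finitely_additive m ->
  borel F -> semivar_le m F S -> semivar_le m setT S' ->
  step_integral m s z -> step_integral m s' z' -> 0 <= c -> 0 <= d ->
  (forall w, F w -> rnorm (s w - s' w) <= c) ->
  (forall w, ~ F w -> rnorm (s w - s' w) <= d) ->
  rnorm (z - z') <= c * S + d * S'.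
Proof.
move=> fm bF mS mS' [I [a [A [bA tA cA sa ->]]]] [J [b [B [bB tB cB sb ->]]]].
move=> c0 d0 ssc ssd.
have mAE i : m (A i) = \sum_j m (A i `&` B j).
  by apply: finitely_additive_cover => //; rewrite cB.
have mBE j : m (B j) = \sum_i m (A i `&` B j).
  under eq_bigr do rewrite setIC.
  by apply: finitely_additive_cover => //; rewrite cA.
pose C (ij : I * J) := A ij.1 `&` B ij.2.
pose e (ij : I * J) := a ij.1 - b ij.2.
have bC ij : borel (C ij) by exact: borelI.
have tC : trivIset setT C.
  move=> [i j] [i' j'] _ _ [w [[/= ? ?] [/= ? ?]]].
  by congr pair; [apply: tA|apply: tB] => //; exists w.
have -> : \sum_i a i *: m (A i) - \sum_j b j *: m (B j) =
    \sum_ij e ij *: m (C ij).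
  rewrite -(pair_bigA _ (fun i j => (a i - b j) *: m (A i `&` B j)))/=.
  under [in RHS]eq_bigr do under eq_bigr do rewrite scalerBl.
  under [in RHS]eq_bigr do rewrite sumrB -scaler_sumr -mAE.
  rewrite sumrB exchange_big; congr (_ - _).
  by apply: eq_bigr => j _; rewrite -scaler_sumr -mBE.
have mCE ij : m (C ij) = m (C ij `&` F) + m (C ij `\` F).
  rewrite -fm; first by rewrite setDE -setIUr setUv setIT.
  - exact: borelI.
  - exact: borelD.
  - by rewrite setDE setIACA setICr setI0.
under eq_bigr do rewrite mCE scalerDr.
have eE ij w : C ij w -> e ij = s w - s' w.
  by move=> [Aw Bw]; rewrite /e (sa _ _ Aw) (sb _ _ Bw).
rewrite big_split (le_trans (rnormD _ _))//= lerD//.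
  apply: (semivar_le_sum (F := F)) => // [ij|ij ij' _ _ [w [[? _] [? _]]]|ij w].
  - exact: borelI.
  - by apply: tC => //; exists w.
  - by move=> [Cw Fw]; rewrite (eE _ _ Cw) ssc.
apply: (semivar_le_sum (F := setT)) => //
  [|ij|ij ij' _ _ [w [[? _] [? _]]]|ij w].
- exact: borelT.
- exact: borelD.
- by apply: tC => //; exists w.
- by move=> [Cw Fw]; rewrite (eE _ _ Cw) ssd.
Qed.

Lemma uniform_cvgP (s : nat -> Omega -> K) (phi : Omega -> K) :
  {uniform, s @ \oo --> phi} <->
  forall e : R, 0 < e ->
    exists N, forall n, (N <= n)%N -> forall w, rnorm (phi w - s n w) < e.
Proof.
split=> [h e e0|h P /uniform_nbhs[E [entE EP]]].
  have e0' : 0 < ofR e :> K by rewrite -(ofR0 R k) ofR_lt.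
  have [|N _ NP] := h [set f | forall w, ball (phi w) (ofR e) (f w)].
    apply/uniform_nbhs; exists [set xy | ball xy.1 (ofR e) xy.2]; split.
      exact: (entourage_ball _ (PosNum e0')).
    by move=> f /= fP w; exact: fP.
  by exists N => n Nn w; have := NP n Nn w; rewrite rnorm_lt.
move: entE; rewrite -entourage_ballE => -[e /scalar_gt0_ofR[e0 eE] eE'].
have [N NP] := h _ e0; exists N => // n /NP {}NP; apply: EP => w _.
by apply: eE'; rewrite /= /ball/= -eE -rnorm_lt.
Qed.

(** The function [phi - \1_E] vanishes off [F] and has modulus at most [2], so
    that the simple functions approximating it are small off [F]. *)
Lemma integral_near_measure m (phi : Omega -> K) (z : Z) E F (S : R) :
  finitely_additive m -> bounded_measure m -> is_vector_integral m phi z ->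
  borel E -> borel F -> semivar_le m F S ->
  (forall w, rnorm (phi w) <= 1) -> (forall w, ~ F w -> phi w = \1_E w) ->
  rnorm (m E - z) <= 2 * S.
Proof.
move=> fm /bounded_measure_semivar[S' mS'] [s [ss /uniform_cvgP us]].
move=> /cvg_seq_rnormP sz bE bF mS phi1 phiF.
have S0 := semivar_le_ge0 bF fm mS.
have S'0 := semivar_le_ge0 (@borelT _) fm mS'.
apply/ler_addgt0Pr => e e0.
pose d := e / (S + S' + 1).
have SS : 0 < S + S' + 1 by rewrite ltr_wpDl// addr_ge0.
have d0 : 0 < d by rewrite divr_gt0.
have dE : d * (S + S' + 1) = e by rewrite divfK// gt_eqF.
have [N1 N1P] := us _ d0; have [N2 N2P] := sz _ d0.
pose n := maxn N1 N2.
have := @step_integral_sub m (\1_E) (s n) (m E) _ F S S' (2 + d) d fm bF mS mS'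
  (indic_step_integral fm bE) (simple_step_integral m (ss n)).
have phis w : rnorm (phi w - s n w) <= d by rewrite ltW// N1P// leq_maxl.
have indE w : \1_E w - s n w = (\1_E w - phi w) + (phi w - s n w).
  by rewrite addrA subrK.
have -> // : 0 <= 2 + d by rewrite addr_ge0// ltW.
move=> /(_ isT (ltW d0)) h.
have : rnorm (m E - simple_fun_integral m (s n)) <= (2 + d) * S + d * S'.
  apply: h => w; rewrite indE => Fw; last by rewrite phiF// subrr add0r -phiF.
  rewrite (le_trans (rnormD _ _))// lerD// (le_trans (rnormD _ _))//.
  rewrite rnormN (_ : 2 = 1 + 1)// lerD// indicE.
  by case: (_ \in _); rewrite ?rnorm1 ?rnorm0.
have := N2P n (leq_maxr _ _); rewrite rnormB => h2 h3.
rewrite -[m E](subrK (simple_fun_integral m (s n))) -addrA.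
rewrite (le_trans (rnormD _ _))//.
rewrite -dE; move: h2 h3; lra.
Qed.

End step_integral.

Section functional_of_measure.
Variables (R : realType) (k : scalar_kind) (Omega : topologicalType).
Local Notation K := (scalars R k).
Variables Z W : normedModType K.
Variables (m : set Omega -> Z) (L : bop Z W).

Lemma bop_sum I (r : seq I) (P : pred I) (F : I -> Z) :
  L (\sum_(i <- r | P i) F i) = \sum_(i <- r | P i) L (F i).
Proof. by apply: big_morph; [exact: bopD|exact: bop0]. Qed.

Lemma bopN z : L (- z) = - L z.
Proof. by rewrite -scaleN1r bopZ scaleN1r. Qed.

Lemma bopB z z' : L (z - z') = L z - L z'.
Proof. by rewrite bopD bopN. Qed.

Lemma rnorm_bop_le z : rnorm (L z) <= rnorm L * rnorm z.
Proof. by rewrite (le_trans (le_opnorm L z))// /rnorm ofRK. Qed.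

Lemma finitely_additive_bop :
  finitely_additive m -> finitely_additive (fun E => L (m E)).
Proof. by move=> fm A B bA bB AB; rewrite fm// bopD. Qed.

Lemma semivar_le_bop F S : borel F -> finitely_additive m ->
  semivar_le m F S -> semivar_le (fun E => L (m E)) F (rnorm L * S).
Proof.
move=> bF fm mS; have fLm := finitely_additive_bop fm.
apply/semivar_leP => // I A e bA tA AF e1.
have -> : \sum_i e i *: L (m (A i)) = L (\sum_i e i *: m (A i)).
  by rewrite bop_sum; apply: eq_bigr => i _; rewrite bopZ.
rewrite (le_trans (rnorm_bop_le _))// ler_wpM2l ?rnorm_ge0//.
by move/(semivar_leP _ bF fm) : mS; exact.
Qed.

Lemma bounded_measure_bop : finitely_additive m -> bounded_measure m ->
  bounded_measure (fun E => L (m E)).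
Proof.
move=> fm /bounded_measure_semivar[S /(semivar_le_bop (@borelT _) fm)].
by move=> h; apply: le_lt_trans h (ltry _).
Qed.

Lemma cvg_bop (u : nat -> Z) z :
  u @ \oo --> z -> (L (u n)) @[n --> \oo] --> L z.
Proof.
move=> /cvg_seq_rnormP h; apply/cvg_seq_rnormP => e e0.
have L0 : 0 < rnorm L + 1 by rewrite ltr_wpDl// rnorm_ge0.
have [N NP] := h _ (divr_gt0 e0 L0); exists N => n /NP.
rewrite ltr_pdivlMr// -bopB; apply: le_lt_trans.
by rewrite (le_trans (rnorm_bop_le _))// mulrC ler_wpM2l ?rnorm_ge0// lerDl.
Qed.

Lemma is_vector_integral_bop phi z : is_vector_integral m phi z ->
  is_vector_integral (fun E => L (m E)) phi (L z).
Proof.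
move=> [s [ss us sz]]; exists s; split=> //.
have -> : (fun n => simple_fun_integral (fun E => L (m E)) (s n)) =
    (fun n => L (simple_fun_integral m (s n))).
  apply/funext => n; have [fs _] := ss n.
  rewrite /simple_fun_integral !fsbig_finite// bop_sum.
  by apply: eq_bigr => a _; rewrite bopZ.
exact: cvg_bop.
Qed.

End functional_of_measure.

Section integral_existence.
Variables (R : realType) (k : scalar_kind) (Omega : compactHausdorffType).
Local Notation K := (scalars R k).

Lemma simple_fun_ite E (a : K) (s : Omega -> K) : borel E -> simple_fun s ->
  simple_fun (fun w => if w \in E then a else s w).
Proof.
move=> bE [fs bs]; split.
  apply: (@sub_finite_set _ _ ([set a] `|` range s)).
    by move=> _ [w _ <-]; case: ifP => _; [left|right; exists w].
  by rewrite finite_setU.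
move=> b.
have -> : (fun w => if w \in E then a else s w) @^-1` [set b] =
    (E `&` [set w | a = b]) `|` ((s @^-1` [set b]) `\` E).
  apply/seteqP; split=> w /=.
    case: ifPn => [/set_mem Ew ->|/negP Ew swb]; first by left.
    by right; split=> // /mem_set.
  by move=> [[Ew <-]|[swb nEw]]; [rewrite mem_set|rewrite memNset].
apply: borelU; last exact: borelD.
have [->|ab] := pselect (a = b).
  by rewrite (_ : [set w | _] = setT) ?setIT//; apply/seteqP; split.
rewrite (_ : [set w | _] = set0) ?setI0; first exact: borel0.
by apply/seteqP; split.
Qed.

Lemma simple_fun_cst (a : K) : simple_fun (fun _ : Omega => a).
Proof.
split; first by apply: (@sub_finite_set _ _ [set a]) => // _ [w _ <-].
move=> b; have [->|ab] := pselect (a = b).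
  by rewrite (_ : _ @^-1` _ = setT); [exact: borelT|apply/seteqP; split].
by rewrite (_ : _ @^-1` _ = set0); [exact: borel0|apply/seteqP; split].
Qed.

(** The range of [phi] is covered by finitely many balls; the value of [s] is
    the centre of the first one that contains the value of [phi]. *)
Lemma simple_approx (phi : cfun Omega (K^o)) (e : R) : 0 < e ->
  exists s, simple_fun s /\ forall w, rnorm (phi w - s w) < e.
Proof.
move=> e0; pose B (a : K^o) := [set b : K^o | rnorm (b - a) < e].
have e0' : 0 < ofR e :> K by rewrite -(ofR0 R k) ofR_lt.
have oB a : open (B a).
  rewrite (_ : B a = ball a (ofR e)); first exact: ball_open.
  by apply/seteqP; split=> b; rewrite /B /ball/= rnormB rnorm_lt.
have h (l : seq K) : exists s, simple_fun s /\
    forall w, (exists2 a, a \in l & B a (phi w)) -> rnorm (phi w - s w) < e.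
  elim: l => [|a l [s [ss sP]]].
    by exists (fun=> 0); split; [exact: simple_fun_cst|move=> w []].
  exists (fun w => if w \in phi @^-1` B a then a else s w); split.
    apply: simple_fun_ite => //; apply: borel_open; apply: open_comp => // w _.
    exact: cfunP.
  move=> w [b]; rewrite inE; case: ifPn => [/set_mem//|/negP Bw].
  move=> /orP[/eqP ->|bl Bbw]; first by move=> h; case: Bw; rewrite inE.
  by apply: sP; exists b.
have := continuous_compact (continuous_subspaceT (@cfunP _ _ _ _ phi)) compactT.
rewrite compact_cover => /(_ K setT B (fun x _ => oB x))[|l _ lP].
  by move=> a _; exists a => //; rewrite /B /= subrr rnorm0.
have [s [ss sP]] := h (finmap.enum_fset l); exists s; split=> // w; apply: sP.
by have [|x xl Ox] := lP (phi w); [exists w|exists x].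
Qed.

(** As [m] has bounded semivariation, the integrals of uniform approximations
    of [phi] by simple functions form a Cauchy sequence. *)
Lemma vector_integralP (Z : normedModType K) (m : set Omega -> Z)
    (phi : cfun Omega K^o) : cauchy_complete Z -> finitely_additive m ->
  bounded_measure m -> is_vector_integral m phi (vector_integral m phi).
Proof.
move=> cZ fm bm; have [S mS] := bounded_measure_semivar bm.
have S0 := semivar_le_ge0 (@borelT _) fm mS.
suff [z zP] : exists z, is_vector_integral m phi z.
  by apply: (@xgetPex _ 0 [set z | is_vector_integral m phi z]); exists z.
have /choice[s sP] n : exists s, simple_fun s /\
    forall w, rnorm (phi w - s w) < n.+1%:R^-1 by exact: simple_approx.
have us : {uniform, s @ \oo --> (phi : Omega -> K)}.
  apply/uniform_cvgP => e e0; exists (Num.truncn e^-1) => n en w.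
  have [_ /(_ w) /lt_le_trans] := sP n; apply.
  rewrite invf_ple ?posrE// ltW// (lt_le_trans (truncnS_gt _))//.
  by rewrite ler_nat ltnS.
have [z zP] : exists z : Z, (simple_fun_integral m (s n)) @[n --> \oo] --> z.
  apply: cZ => e e0.
  have SS : 0 < 2 * S + 1 by rewrite ltr_wpDl// mulr_ge0.
  move/uniform_cvgP : us => /(_ _ (divr_gt0 e0 SS))[N NP].
  exists N => n l Nn Nl.
  have := @step_integral_sub _ _ _ _ m (s n) (s l) _ _ setT S S
    (2 * (e / (2 * S + 1))) 0 fm (@borelT _) mS mS
    (simple_step_integral m (sP n).1) (simple_step_integral m (sP l).1).
  have d0 : 0 < e / (2 * S + 1) by exact: divr_gt0.
  rewrite mul0r addr0 => /(_ _ (lexx 0)) h.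
  rewrite (le_trans (h _ _ _))//; first by rewrite mulr_ge0// ltW.
    move=> w _; rewrite -(subrK (phi w) (s n w)) -addrA.
    rewrite (le_trans (rnormD _ _))// mulrDl mul1r lerD// ltW//.
      by rewrite rnormB NP.
    exact: NP.
    by move=> w [].
  have : e / (2 * S + 1) * (2 * S + 1) = e by rewrite divfK// gt_eqF.
  by move: d0; move: (e / _) => d; lra.
by exists z, s; split=> // n; have [] := sP n.
Qed.

End integral_existence.

(** * Spaces of operators *)

Section operator_spaces.
Variables (R : realType) (k : scalar_kind).
Local Notation K := (scalars R k).
Variables X Y : normedModType K.

Lemma rnorm_bop_leP (f : bop X Y) (M : R) : 0 <= M ->
  (forall x, rnorm (f x) <= M * rnorm x) -> rnorm f <= M.
Proof.
by move=> M0 fM; rewrite /rnorm ofRK -lee_fin fineK ?opnorm_fin// opnorm_le.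
Qed.

Lemma cvg_rnorm_le (u : nat -> Y) (l v : Y) (c : R) N : u @ \oo --> l ->
  (forall n, (N <= n)%N -> rnorm (u n - v) <= c) -> rnorm (l - v) <= c.
Proof.
move=> /cvg_seq_rnormP ul uv; apply/ler_addgt0Pr => e e0.
have [N' N'P] := ul _ e0; pose n := maxn N N'.
rewrite -(subrK (u n) l) -addrA addrC (le_trans (rnormD _ _))// lerD//.
  by rewrite uv// leq_maxl.
by rewrite ltW// N'P// leq_maxr.
Qed.

Lemma bop_cauchy_complete : cauchy_complete Y -> cauchy_complete (bop X Y).
Proof.
move=> cY u uc.
have uxc x : exists y : Y, (fun n => u n x) @ \oo --> y.
  apply: cY => e e0; have x0 : 0 < rnorm x + 1 by rewrite ltr_wpDl// rnorm_ge0.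
  have [N NP] := uc _ (divr_gt0 e0 x0); exists N => n l Nn Nl.
  rewrite (le_trans (rnorm_bop_le (u n - u l) x))//.
  rewrite (le_trans (ler_wpM2r (rnorm_ge0 _) (NP n l Nn Nl)))//.
  by rewrite mulrAC ler_pdivrMr// ler_wpM2l ?lerDl// ltW.
have [f fP] := choice uxc.
have fl : bounded_linear f.
  split.
    move=> a x y; have /cvg_unique := fP (a *: x + y); apply => //.
    rewrite (_ : (fun n => _) = (fun n => a *: u n x + u n y)).
      by apply: cvgD; [apply: cvgZ; [exact: cvg_cst|]|]; exact: fP.
    by apply/funext => n; rewrite bopD bopZ.
  have [N NP] := uc _ ltr01; exists (rnorm (u N) + 1) => x.
  rewrite -[f x]subr0 (cvg_rnorm_le (N := N) (fP x))// => n Nn; rewrite subr0.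
  rewrite (le_trans (rnorm_bop_le _ _))// ler_wpM2r ?rnorm_ge0//.
  by rewrite -(subrK (u N) (u n)) addrC (le_trans (rnormD _ _))// lerD2l NP.
exists (mkbop fl); apply/cvg_seq_rnormP => e e0.
have [N NP] := uc _ (divr_gt0 e0 (ltr0Sn R 1)); exists N => n Nn.
rewrite (@le_lt_trans _ _ (e / 2))//; last first.
  by rewrite ltr_pdivrMr// mulr_natr mulr2n ltrDl.
apply: rnorm_bop_leP => [|x]; first by rewrite divr_ge0// ltW.
apply: (cvg_rnorm_le (N := N) (fP x)) => l Nl.
rewrite (le_trans (rnorm_bop_le (u l - u n) x))// ler_wpM2r ?rnorm_ge0//.
exact: NP.
Qed.

Lemma evaluation_subproof (x : X) : bounded_linear (fun f : bop X Y => f x).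
Proof.
by split=> // ; exists (rnorm x) => f; rewrite mulrC rnorm_bop_le.
Qed.

Definition evaluation (x : X) : bop (bop X Y) Y :=
  mkbop (evaluation_subproof x).

End operator_spaces.

(** * Regular measures *)

Section regular_measures.
Variables (R : realType) (k : scalar_kind) (Omega : compactHausdorffType).
Local Notation K := (scalars R k).

Lemma compact_borel (C : set Omega) : compact C -> borel C.
Proof.
by move=> cC; apply: borel_closed; exact: compact_closed (@hausdorffT _) cC.
Qed.

Lemma bump_function (C U : set Omega) : compact C -> open U -> C `<=` U ->
  exists phi : cfun Omega K^o, [/\ forall w, rnorm (phi w) <= 1,
    forall w, C w -> phi w = 1 & forall w, ~ U w -> phi w = 0].
Proof.
move=> cC oU CU.
have nU := compact_normal (@hausdorffT Omega) (@compactT Omega).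
have /(@uniform_separatorP _ R)[f [cf f01 f0 f1]] : uniform_separator (~` U) C.
  apply: (normal_uniform_separator nU).
  - exact: open_closedC.
  - exact: compact_closed (@hausdorffT _) cC.
  - by rewrite setIC; apply/disjoints_subset; rewrite setCK.
have cphi : continuous (fun w => ofR (f w) : K^o).
  move=> w; apply/cvg_rnormP => e e0.
  have /cvgrPdist_lt/(_ _ e0) := cf w; apply: filterS => v.
  by rewrite -ofRB rnorm_ofRE.
exists (mkcfun cphi); split=> w /=.
- have /f01 : range f (f w) by exists w.
  rewrite /= in_itv/= => /andP[fw0 fw1].
  by rewrite rnorm_ofR.
- by move=> Cw; rewrite (_ : f w = 1) ?ofR1//; apply: f1; exists w.
- by move=> Uw; rewrite (_ : f w = 0) ?ofR0//; apply: f0; exists w.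
Qed.

Lemma semivar_le_ler (Z : normedModType K) (m : set Omega -> Z) F S S' :
  S <= S' -> semivar_le m F S -> semivar_le m F S'.
Proof. by move=> SS' mS; apply: le_trans mS _; rewrite lee_fin. Qed.

(** A finite union of compact subsets of [E] and a finite intersection of open
    sets containing [E] serve all the measures of the list. *)
Lemma common_approximation (I : eqType) (nu : I -> set Omega -> K^o)
    (l : seq I) E (e : R) :
  (forall i, i \in l -> finitely_additive (nu i)) ->
  (forall i, i \in l -> regular_measure (nu i)) -> borel E -> 0 < e ->
  exists C U, [/\ compact C, open U, C `<=` E, E `<=` U &
    forall i, i \in l -> semivar_le (nu i) (U `\` C) e].
Proof.
move=> + + bE e0; elim: l => [|i l ih fl rl].
  move=> _ _; exists set0, setT; split=> //; [exact: compact0|exact: openT].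
have [C [U [cC oU CE EU lUC]]] : exists C U, [/\ compact C, open U, C `<=` E,
    E `<=` U & forall i, i \in l -> semivar_le (nu i) (U `\` C) e].
  by apply: ih => j jl; [apply: fl|apply: rl]; rewrite inE jl orbT.
have [C' [U' [cC' oU' CE' EU' iUC]]] := rl i (mem_head _ _) E e bE e0.
have bC := compact_borel cC; have bC' := compact_borel cC'.
have bU := borel_open oU; have bU' := borel_open oU'.
have bUC : borel (U `\` C) by exact: borelD.
have bUC' : borel (U' `\` C') by exact: borelD.
exists (C `|` C'), (U `&` U'); split.
- exact: compactU.
- exact: openI.
- by move=> w [/CE|/CE'].
- by move=> w Ew; split; [exact: EU|exact: EU'].
have bUC2 : borel ((U `&` U') `\` (C `|` C')).
  by apply: borelD; [exact: borelI|exact: borelU].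
move=> j; rewrite inE => /orP[/eqP ->|jl].
  apply: (semivar_le_sub (F := U' `\` C')) => //; first exact/fl/mem_head.
    exact: ltW.
  by move=> w [[? ?]]; rewrite not_orP => -[].
apply: (semivar_le_sub (F := U `\` C)) => //.
- by apply: fl; rewrite inE jl orbT.
- exact: lUC.
- by move=> w [[? ?]]; rewrite not_orP => -[].
Qed.

(** Take a bump function between the two sets of a common approximation: it
    differs from the indicator of [E] only between them. *)
Lemma common_bump (I : eqType) (nu : I -> set Omega -> K^o) (l : seq I) E
    (e : R) :
  (forall i, i \in l -> finitely_additive (nu i)) ->
  (forall i, i \in l -> bounded_measure (nu i)) ->
  (forall i, i \in l -> regular_measure (nu i)) -> borel E -> 0 < e ->
  exists phi : cfun Omega K^o, (forall w, rnorm (phi w) <= 1) /\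
    forall i z, i \in l -> is_vector_integral (nu i) phi z ->
      rnorm (nu i E - z) <= e.
Proof.
move=> fl bl rl bE e0; have e2 : 0 < e / 2 by rewrite divr_gt0.
have [C [U [cC oU CE EU lUC]]] := common_approximation fl rl bE e2.
have [phi [phi1 phiC phiU]] := bump_function cC oU (subset_trans CE EU).
exists phi; split=> // i z il iz; rewrite (_ : e = 2 * (e / 2)); last first.
  by rewrite mulrC divfK.
apply: (integral_near_measure (F := U `\` C) (fl i il) (bl i il) iz bE) => //.
- by apply: borelD; [exact: borel_open|exact: compact_borel].
- exact: lUC.
- move=> w UCw; rewrite indicE.
  have [Cw|Cw] := pselect (C w); first by rewrite phiC// mem_set//; exact: CE.
  rewrite phiU => [|Uw]; last exact: UCw.
  rewrite memNset// => Ew; apply: UCw; split=> //; exact: EU.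
Qed.

(** Both measures of [E] are close to the common integral of one bump
    function. *)
Lemma regular_measures_eq (nu nu' : set Omega -> K^o) E :
  finitely_additive nu -> finitely_additive nu' ->
  bounded_measure nu -> bounded_measure nu' ->
  regular_measure nu -> regular_measure nu' ->
  (forall phi : cfun Omega K^o, exists z,
    is_vector_integral nu phi z /\ is_vector_integral nu' phi z) ->
  borel E -> nu E = nu' E.
Proof.
move=> fn fn' bn bn' rn rn' nn bE; apply/eqP; rewrite -subr_eq0; apply/eqP.
apply: rnorm0_eq0; apply/eqP; rewrite eq_le rnorm_ge0 andbT.
apply/ler_addgt0Pr => e e0; rewrite add0r.
pose f (b : bool) := if b then nu else nu'.
have [||||phi [_ phiP]] :=
  @common_bump bool f [:: true; false] E (e / 2) _ _ _ bE.
- by case.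
- by case.
- by case.
- by rewrite divr_gt0.
have [z [z1 z2]] := nn phi.
have h1 := phiP true z isT z1; have h2 := phiP false z isT z2.
rewrite -(subrK z (nu E)) -addrA (le_trans (rnormD _ _))// [leRHS]splitr lerD//.
by rewrite rnormB.
Qed.

End regular_measures.

(** * Elementary tensors belong to [Cp] *)

Section single_sequences.
Variables (R : realType) (k : scalar_kind) (Omega : compactHausdorffType).
Local Notation K := (scalars R k).

Definition single (V : normedModType K) (v : V) (n : nat) : V :=
  if n is 0 then v else 0.

Lemma ellp_norm_single (V : normedModType K) (p : \bar R) (v : V) :
  (1 <= p)%E -> (ellp_norm p (single v) <= (rnorm v)%:E)%E.
Proof.
rewrite /ellp_norm; case: p => [r r1|_|//]; last first.
  rewrite unlock; case: ifPn => [_|_]; last by rewrite lee_fin rnorm_ge0.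
  apply/ess_supP; apply/aeW => -[|n] /=;
    rewrite ?rnorm0 ?normr0 ?lee_fin ?rnorm_ge0//.
  by rewrite ger0_norm// rnorm_ge0.
have r0 : (0 < r)%R by rewrite (lt_le_trans ltr01)// -lee_fin.
rewrite Lnorm_counting// (@nneseries_split _ _ 0 1)//.
rewrite big_nat1 /= eseries0 ?adde0; last first.
  by move=> [//|n] _ _ /=; rewrite rnorm0 normr0 powR0// gt_eqF.
  rewrite poweR_EFin -powRrM mulfV ?gt_eqF// powRr1 ?normr_ge0//.
  by rewrite ger0_norm// rnorm_ge0.
by move=> n _; exact: poweR_ge0.
Qed.

Lemma single_series (V : normedModType K) (a : K^o) (v : V) :
  (\sum_(0 <= i < n) single a i *: single v i) @[n --> \oo] --> a *: v.
Proof.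
apply/cvg_seq_rnormP => e e0; exists 1 => -[//|n] _.
rewrite big_nat_recl//= big1 ?addr0 ?subrr ?rnorm0// => i _.
by rewrite scaler0.
Qed.

(** The range of [phi x] is contained in the multiples of the single vector
    [M x] by scalars of modulus at most [1], where [M] bounds [phi]. *)
Lemma Cp_cfun_scale (X : normedModType K) (p : \bar R)
    (phi : cfun Omega K^o) (x : X) : (1 <= p)%E -> Cp p (cfun_scale phi x).
Proof.
move=> p1; pose M := supnorm phi + 1.
have M0 : 0 < M by rewrite ltr_wpDl// supnorm_ge0.
exists (single (ofR M *: x)); split.
  rewrite /ellp/=; case: ifPn => [_|_]; last first.
    exact: le_lt_trans (ellp_norm_single _ p1) (ltry _).
  apply/cvg_seq_rnormP => e e0; exists 1 => -[//|n] _ /=.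
  by rewrite subrr rnorm0.
move=> _ [w _ <-]; exists (single (phi w * ofR M^-1 : K^o)).
  apply: le_trans (ellp_norm_single _ (hoelder_conj_ge1 p1)) _.
  rewrite lee_fin rnormM rnorm_ofR ?invr_ge0 ?(ltW M0)// ler_pdivrMr// mul1r.
  by rewrite (le_trans (le_supnorm phi w))// lerDl.
have := @single_series X (phi w * ofR M^-1 : K^o) (ofR M *: x).
by rewrite scalerA -mulrA -ofRM mulVf ?gt_eqF// ofR1 mulr1.
Qed.

End single_sequences.

(** * Weakly compact operators *)

Section weak_compactness.
Variables (R : realType) (k : scalar_kind).
Local Notation K := (scalars R k).
Variable Z : normedModType K.

Lemma weak_continuous (w : dual Z) : continuous (w : weak Z -> K^o).
Proof.
move=> z.
pose F (z : Z) : {ptws dual Z -> K^o} := fun f => f z.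
pose e (h : {ptws dual Z -> K^o}) : K^o := h w.
apply: (@continuous_comp (weak Z) {ptws dual Z -> K^o} K^o F e).
  exact: (@initial_continuous _ _ F).
exact: (@proj_continuous (dual Z) (fun=> K^o) w).
Qed.

(** The image of the ball being relatively weakly compact, an element of the
    bidual in its weak-star closure is represented by a weak cluster point. *)
Lemma weakly_compact_bidual (X : normedModType K) (T : bop X Z)
    (Phi : bidual Z) :
  weakly_compact T ->
  (forall (l : seq (dual Z)) (e : R), 0 < e -> exists2 x, rnorm x <= 1 &
    forall w, w \in l -> rnorm (Phi w - w (T x)) <= e) ->
  exists z, Phi = canonical_embedding Z z.
Proof.
move=> [B AB [cB clB]] h.
pose G (le : seq (dual Z) * R) : set (weak Z) :=
  [set T x | x in [set x | rnorm x <= 1 /\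
    forall w, w \in le.1 -> rnorm (Phi w - w (T x)) <= le.2]].
pose D := [set le : seq (dual Z) * R | 0 < le.2].
have FG : ProperFilter (filter_from D G).
  apply: filter_from_proper; last first.
    move=> [l e] /= e0; have [x x1 xP] := h l e e0.
    by exists (T x), x.
  apply: filter_from_filter; first by exists ([::], 1) => /=; exact: ltr01.
  move=> [l e] [l' e'] /= e0 e'0; exists (l ++ l', Num.min e e') => /=.
    by rewrite /D/= lt_min e0.
  move=> _ [x [x1 xP] <-]; split; exists x => //; split=> // w wl.
    have := xP w; rewrite /= mem_cat wl => /(_ isT).
    by rewrite le_min => /andP[].
  have := xP w; rewrite /= mem_cat wl orbT => /(_ isT).
  by rewrite le_min => /andP[].
have FB : filter_from D G B.
  exists ([::], 1) => /=; first exact: ltr01.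
  by move=> _ [x [x1 _] <-]; apply: AB; exists x.
have [z [_ zP]] := cB _ FG FB.
exists z; apply: bop_eqP => w /=; apply/eqP; rewrite -subr_eq0; apply/eqP.
apply: rnorm0_eq0; apply/eqP; rewrite eq_le rnorm_ge0 andbT.
apply/ler_addgt0Pr => e e0; rewrite add0r.
have e2 : 0 < e / 2 by rewrite divr_gt0.
have /cvg_rnormP/(_ _ e2) nz := @weak_continuous w z.
have [|z' [[x [x1 /(_ w (mem_head _ _))/= xw] <-] /= zx]] :=
  zP (G ([:: w], e / 2)) [set z' | rnorm (w z - w z') < e / 2] _ nz.
  by exists ([:: w], e / 2).
rewrite -(subrK (w (T x)) (Phi w)) -addrA (le_trans (rnormD _ _))//.
by rewrite [leRHS]splitr lerD// rnormB ltW.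
Qed.

End weak_compactness.

(** * Countable additivity of regular measures *)

Section regular_tail.
Variables (R : realType) (k : scalar_kind) (Omega : compactHausdorffType).
Local Notation K := (scalars R k).

Lemma compact_decreasing_closed (L : nat -> set Omega) :
  (forall n, closed (L n)) -> (forall n, L n.+1 `<=` L n) ->
  \bigcap_n L n = set0 -> exists n, L n = set0.
Proof.
move=> cL dL L0; apply: contrapT => /forallNP Ln0.
have dLe n n' : (n <= n')%N -> L n' `<=` L n.
  move=> /subnK <-; elim: (n' - n)%N => [//|j ih].
  by rewrite addSn; apply: subset_trans ih; exact: dL.
have FL : ProperFilter (filter_from setT L).
  apply: filter_from_proper; last first.
    by move=> n _; apply/set0P/eqP/Ln0.
  apply: filter_from_filter; first by exists 0%N.
  move=> i j _ _; exists (maxn i j) => // w Lw; split; apply: dLe Lw.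
    exact: leq_maxl.
  exact: leq_maxr.
have [|w [_ wL]] := @compactT Omega _ FL; first by exists 0%N.
suff : (\bigcap_n L n) w by rewrite L0.
move=> n _; apply: cL => B Bw; apply: wL => //.
by exists n.
Qed.

Variable Z : normedModType K.

(** Inner approximations of the sets of a sequence decreasing to the empty set
    have, by compactness, finite intersections that are empty. *)
Lemma semivar_tail (m : set Omega -> Z) (B : nat -> set Omega) (e : R) :
  finitely_additive m -> regular_measure m -> (forall n, borel (B n)) ->
  (forall n, B n.+1 `<=` B n) -> \bigcap_n B n = set0 -> 0 < e ->
  exists N, forall n, (N <= n)%N -> semivar_le m (B n) e.
Proof.
move=> fm rm bB dB B0 e0.
have dBe n n' : (n <= n')%N -> B n' `<=` B n.
  move=> /subnK <-; elim: (n' - n)%N => [//|j ih].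
  by rewrite addSn; apply: subset_trans ih; exact: dB.
have /choice[C CP] n : exists C, [/\ compact C, C `<=` B n &
    semivar_le m (B n `\` C) (e / 2 ^+ n.+1)].
  have en : 0 < e / 2 ^+ n.+1 by rewrite divr_gt0// exprn_gt0.
  have [C [U [cC oU CB BU mUC]]] := rm _ _ (bB n) en.
  exists C; split=> //; apply: (semivar_le_sub (F := U `\` C)) => //.
  - by apply: borelD; [exact: borel_open|exact: compact_borel].
  - by apply: borelD => //; exact: compact_borel.
  - exact: ltW.
  - exact: setSD.
pose L := fix L n := if n is n'.+1 then L n' `&` C n else C 0%N.
have cL n : closed (L n).
  have cC i : closed (C i).
    by have [cC _ _] := CP i; exact: compact_closed (@hausdorffT _) cC.
  elim: n => [|n ih] /=; first exact: cC.
  by apply: closedI => //; exact: cC.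
have LC n : L n `<=` C n by case: n => [//|n]; exact: subIsetr.
have [N LN] : exists N, L N = set0.
  apply: compact_decreasing_closed => // [n|]; first exact: subIsetl.
  rewrite -subset0 -B0 => w Lw n _; have [_ CB _] := CP n.
  by apply: CB; apply: LC; exact: Lw.
(* The error [e / 2 ^+ n.+1] of each [C n] makes a geometric series. *)
have mBL n : semivar_le m (B n `\` L n) (e * (1 - (2 ^+ n.+1)^-1)).
  elim: n => [|n ih].
    have [_ _] := CP 0%N; rewrite (_ : e / _ = e * (1 - (2 ^+ 1)^-1))//.
    by rewrite expr1; lra.
  have -> : e * (1 - (2 ^+ n.+2)^-1) =
      e * (1 - (2 ^+ n.+1)^-1) + e / 2 ^+ n.+2.
    by rewrite (exprS 2 n.+1) invfM; move: (2 ^+ n.+1)^-1 => t; field.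
  have [cC CB mC] := CP n.+1.
  have bL i : borel (L i) by exact: borel_closed.
  have bC := compact_borel cC.
  apply: (semivar_le_sub (F := (B n `\` L n) `|` (B n.+1 `\` C n.+1))) => //.
  - by apply: borelU; exact: borelD.
  - exact: borelD.
  - by apply: semivar_leU => //; exact: borelD.
  - move=> w [Bw nLw]; have [Lw|Lw] := pselect (L n w).
      by right; split=> // Cw; apply: nLw.
    by left; split=> //; exact: dB.
exists N => n Nn; apply: (semivar_le_sub (F := B N)) => //; last exact: dBe.
have := mBL N; rewrite LN setD0; apply: semivar_le_ler.
by rewrite ler_piMr ?ltW// lerBlDr lerDl invr_ge0 exprn_ge0.
Qed.

Lemma tail_cap0 (E : nat -> set Omega) : trivIset setT E ->
  \bigcap_n \bigcup_(i in [set i | (n <= i)%N]) E i = set0.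
Proof.
move=> tE; rewrite -subset0 => w Ew.
have [i _ Eiw] := Ew 0%N I; have [j /= ij Ejw] := Ew i.+1 I.
have ij' : i = j by apply: tE => //; exists w.
by rewrite ij' ltnn in ij.
Qed.

Lemma finitely_additive_bigcup (m : set Omega -> Z) (E : nat -> set Omega)
    (A : nat -> bool) N : finitely_additive m -> (forall n, borel (E n)) ->
  trivIset setT E ->
  m (\bigcup_(i in [set i | A i /\ (i < N)%N]) E i) =
  \sum_(0 <= i < N) if A i then m (E i) else 0.
Proof.
move=> fm bE tE; elim: N => [|N ih].
  rewrite big_nil (_ : \bigcup_(i in _) E i = set0) ?finitely_additive0//.
  by rewrite -subset0 => w [i []].
rewrite big_nat_recr//= -ih; case: ifPn => AN; last first.
  rewrite addr0; congr m; apply: eq_bigcupl; split=> i /= [Ai].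
    rewrite ltnS leq_eqVlt => /orP[/eqP iN|//]; by rewrite iN (negPf AN) in Ai.
  by move=> /ltnW; rewrite ltnS.
rewrite -fm; last first.
- rewrite -subset0 => w [[i [_ /= iN] Eiw] ENw].
  have iN' : i = N by apply: tE => //; exists w.
  by rewrite iN' ltnn in iN.
- exact: bE.
- by apply: borel_bigcup => i _; exact: bE.
congr m; apply/seteqP; split=> w.
  move=> [i /= [Ai]]; rewrite ltnS leq_eqVlt => /orP[/eqP ->|iN] Eiw.
    by right.
  by left; exists i.
move=> [[i /= [Ai iN] Eiw]|ENw]; last by exists N => /=.
by exists i => //=; split=> //; exact: ltnW.
Qed.

(** The measures of the tails of a disjoint sequence tend to [0]. *)
Lemma regular_countably_additive (m : set Omega -> Z) :
  finitely_additive m -> regular_measure m -> countably_additive m.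
Proof.
move=> fm rm E bE tE; apply/cvg_seq_rnormP => e e0.
pose B n := \bigcup_(i in [set i | (n <= i)%N]) E i.
have bB n : borel (B n) by apply: borel_bigcup => i _; exact: bE.
have [||N NP] := @semivar_tail m B (e / 2) fm rm bB _ (tail_cap0 tE).
- by move=> n w [i /= ni Ew]; exists i => //=; exact: ltnW.
- by rewrite divr_gt0.
exists N => n Nn.
have -> : \sum_(0 <= i < n) m (E i) =
    m (\bigcup_(i in [set i | true /\ (i < n)%N]) E i).
  by rewrite (finitely_additive_bigcup (fun=> true)).
set T := \bigcup_(i in [set i | _ /\ _]) E i.
have bT : borel T by apply: borel_bigcup => i _; exact: bE.
have -> : \bigcup_i E i = T `|` B n.
  apply/seteqP; split=> w.
    move=> [i _ Ew]; have [ni|ni] := leqP n i; [right|left]; by exists i.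
  by move=> [[i _ Ew]|[i _ Ew]]; exists i.
rewrite fm//; last first.
  rewrite -subset0 => w [[i [_ /= iN] Eiw] [j /= jn Ejw]].
  have ij : i = j by apply: tE => //; exists w.
  by rewrite ij ltnNge jn in iN.
rewrite addrAC subrr add0r (@le_lt_trans _ _ (e / 2))//; last first.
  by rewrite ltr_pdivrMr// mulr_natr mulr2n ltrDl.
exact: (semivar_le_norm (bB n) (bB n) fm (NP n Nn)).
Qed.

End regular_tail.

(** * The Orlicz-Pettis theorem *)

Section mazur.
Variables (R : realType) (k : scalar_kind).
Local Notation K := (scalars R k).
Variable Z : normedModType K.

(** The Hahn-Banach theorem applied to the distance to the subspace [P]. *)
Lemma annihilating_functional (P : set Z) (x : Z) (d : R) :
  P 0 -> (forall a y y', P y -> P y' -> P (a *: y + y')) ->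
  (forall y, P y -> d <= rnorm (x - y)) ->
  exists w : dual Z, (forall y, P y -> w y = 0) /\ d <= rnorm (w x).
Proof.
move=> P0 PL dP.
pose D x := [set rnorm (x - y) | y in P].
have Di y : has_inf (D y).
  split; first by exists (rnorm (y - 0)), 0.
  by exists 0 => _ [y' _ <-]; exact: rnorm_ge0.
pose q y := inf (D y).
have qP y y' : P y' -> q y <= rnorm (y - y').
  by move=> Py'; apply: ge_inf; [have [] := Di y|exists y'].
have [|||w [wq xw]] := @seminorm_functional _ _ _ q x.
- move=> y y'; rewrite -lerBlDr; apply: lb_le_inf; first by have [] := Di y.
  move=> _ [v Pv <-]; rewrite lerBlDr -lerBlDl.
  apply: lb_le_inf; first by have [] := Di y'.
  move=> _ [v' Pv' <-]; rewrite lerBlDl.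
  have Pvv' : P (v + v') by rewrite -[v]scale1r; exact: PL.
  rewrite (le_trans (qP _ _ Pvv'))// opprD addrACA.
  exact: rnormD.
- move=> a y; have [->|a0] := eqVneq a 0.
    by rewrite scale0r rnorm0 mul0r (le_trans (qP _ _ P0))// subr0 rnorm0.
  have na : 0 < rnorm a by rewrite rnorm_gt0.
  rewrite -ler_pdivrMl//; apply: lb_le_inf; first by have [] := Di y.
  move=> _ [v Pv <-]; rewrite ler_pdivrMl// -rnormZ scalerBr.
  by apply: qP; rewrite -[_ *: _]addr0; exact: PL.
- by exists 1 => y; rewrite mul1r (le_trans (qP _ _ P0))// subr0.
exists w; split.
  move=> y Py; apply: rnorm0_eq0; apply/eqP; rewrite eq_le rnorm_ge0 andbT.
  by rewrite (le_trans (wq y))// (le_trans (qP _ _ Py))// subrr rnorm0.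
apply: le_trans xw; apply: lb_le_inf; first by have [] := Di x.
by move=> _ [y Py <-]; exact: dP.
Qed.

End mazur.

Section orlicz_pettis.
Variables (R : realType) (k : scalar_kind).
Local Notation K := (scalars R k).
Variable Z : normedModType K.
Variables (z : nat -> Z) (s : (nat -> bool) -> Z).

(** [s] is weakly continuous on the Cantor space, and sums the terms of [z]
    over the finite subsets of [nat]. *)
Hypothesis s_weak : forall (w : dual Z) (e : R), 0 < e -> exists N, forall A B,
  (forall i, (i < N)%N -> A i = B i) -> rnorm (w (s A) - w (s B)) <= e.
Hypothesis s_finite : forall A N, (forall i, (N <= i)%N -> A i = false) ->
  s A = \sum_(0 <= i < N) if A i then z i else 0.

Let truncate A N : nat -> bool := fun i => A i && (i < N)%N.

(** Mazur's theorem: [s A] is the weak limit of finite sums of terms of [z], so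
    that a functional vanishing on all the terms of [z] vanishes at [s A]. *)
Lemma subsum_in_span (A : nat -> bool) (e : R) : 0 < e ->
  exists n (a : nat -> K), rnorm (s A - \sum_(0 <= i < n) a i *: z i) < e.
Proof.
move=> e0; apply: contrapT => H.
pose P := [set y | exists n (a : nat -> K), y = \sum_(0 <= i < n) a i *: z i].
have far y : P y -> e <= rnorm (s A - y).
  by move=> [n [a ->]]; rewrite leNgt; apply/negP => ?; apply: H; exists n, a.
have [||w [wP ew]] := annihilating_functional _ _ far.
- by exists 0%N, (fun=> 0); rewrite big_nil.
- move=> c y y' [n [a ->]] [n' [a' ->]].
  pose ext n (a : nat -> K) i := if (i < n)%N then a i else 0.
  have extE N n0 (b : nat -> K) : (n0 <= N)%N ->
      \sum_(0 <= i < n0) b i *: z i = \sum_(0 <= i < N) ext n0 b i *: z i.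
    move=> nN; rewrite [RHS](big_cat_nat (n := n0))//=.
    rewrite [X in _ = _ + X]big_nat [X in _ = _ + X]big1 ?addr0.
      apply: eq_big_nat => i /andP[_ ilt]; by rewrite /ext ilt.
    by move=> i /andP[ni _]; rewrite /ext ltnNge ni scale0r.
  exists (maxn n n'), (fun i => c * ext n a i + ext n' a' i).
  rewrite (extE (maxn n n') n a (leq_maxl _ _)).
  rewrite (extE (maxn n n') n' a' (leq_maxr _ _)).
  rewrite scaler_sumr -big_split/=; apply: eq_bigr => i _.
  by rewrite scalerDl scalerA.
have [N NP] := s_weak w (divr_gt0 e0 (ltr0Sn R 1)).
have wAN : rnorm (w (s A) - w (s (truncate A N))) <= e / 2.
  by apply: NP => i iN; rewrite /truncate iN andbT.
suff w0 : w (s (truncate A N)) = 0.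
  by move: wAN; rewrite w0 subr0; move: ew e0; lra.
apply: wP.
exists N, (fun i => if A i then 1 else 0).
rewrite (@s_finite _ N); last first.
  by move=> i Ni; rewrite /truncate ltnNge Ni andbF.
apply: eq_big_nat => i /andP[_ iN]; rewrite /truncate iN andbT.
by case: ifP; rewrite ?scale1r ?scale0r.
Qed.

Lemma subsum_separable : exists c : nat -> Z,
  forall A (e : R), 0 < e -> exists j, rnorm (s A - c j) < e.
Proof.
have [d dP] := scalar_separable R k.
pose comb (l : seq nat) := \sum_(0 <= i < size l) d (nth 0%N l i) *: z i.
exists (fun j => comb (odflt [::] (unpickle j))) => A e e0.
have e2 : 0 < e / 2 by rewrite divr_gt0.
have [n [a aP]] := subsum_in_span A e2.
pose M := \sum_(0 <= i < n) rnorm (z i) + 1.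
have M0 : 0 < M by rewrite ltr_wpDl// sumr_ge0// => i _; exact: rnorm_ge0.
have /choice[j jP] i := dP (a i) _ (divr_gt0 e2 M0).
exists (pickle (mkseq j n)); rewrite pickleK /= /comb size_mkseq.
rewrite -(subrK (\sum_(0 <= i < n) a i *: z i) (s A)) -addrA.
rewrite (le_lt_trans (rnormD _ _))// [ltRHS]splitr ltr_leD//.
rewrite -sumrB (le_trans (rnorm_sum _ _ _))//.
apply: (@le_trans _ _ (\sum_(0 <= i < n) e / 2 / M * rnorm (z i))).
  apply: ler_sum_nat => i /andP[_ ilt]; rewrite nth_mkseq// -scalerBl rnormZ.
  by rewrite ler_wpM2r ?rnorm_ge0// ltW.
rewrite -mulr_sumr mulrAC ler_pdivrMr// ler_wpM2l ?(ltW e2)//.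
by rewrite lerDl.
Qed.

(** Closed balls are weakly closed, by a norming functional of [s A - c]. *)
Lemma subsum_lsc A (c : Z) (e : R) : e < rnorm (s A - c) ->
  exists N, forall B, (forall i, (i < N)%N -> A i = B i) -> e < rnorm (s B - c).
Proof.
move=> eA; have [w [w1 wA]] := norming_functional (s A - c).
have h0 : 0 < (rnorm (s A - c) - e) / 2 by rewrite divr_gt0// subr_gt0.
have [N NP] := s_weak w h0; exists N => B /NP AB.
apply: lt_le_trans (w1 (s B - c)); rewrite bopB.
have : rnorm (w (s A - c)) <= rnorm (w (s A) - w (s B)) + rnorm (w (s B) - w c).
  by rewrite bopB -{1}(subrK (w (s B)) (w (s A))) -addrA rnormD.
by move: AB wA eA; lra.
Qed.

(** Baire's theorem on the Cantor space: countably many closed balls of radius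
    [e] cover the values of [s], so that one of them contains all the values
    on some cylinder. Otherwise nested cylinders whose values avoid the
    successive balls would have in common a point with a value in no ball. *)
Lemma subsum_cylinder (e : R) : 0 < e -> exists N A c,
  forall B, (forall i, (i < N)%N -> A i = B i) -> rnorm (s B - c) <= e.
Proof.
move=> e0; have [c cP] := subsum_separable.
apply: contrapT => H.
pose cyl (p q : nat * (nat -> bool)) (j : nat) :=
  [/\ (p.1 < q.1)%N, forall i, (i < p.1)%N -> p.2 i = q.2 i &
    forall B, (forall i, (i < q.1)%N -> q.2 i = B i) -> e < rnorm (s B - c j)].
have step (pj : nat * (nat -> bool) * nat) : exists q, cyl pj.1 q pj.2.
  case: pj => -[N A] j /=.
  have [B [AB eB]] : exists B, (forall i, (i < N)%N -> A i = B i) /\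
      e < rnorm (s B - c j).
    apply: contrapT => H'; apply: H; exists N, A, (c j) => B AB.
    by rewrite leNgt; apply/negP => eB; apply: H'; exists B.
  have [N' N'P] := subsum_lsc eB; exists (maxn N.+1 N', B); split=> //=.
    by rewrite leq_max ltnSn.
  by move=> B' BB'; apply: N'P => i iN'; apply: BB'; rewrite leq_max iN' orbT.
have [f fP] := choice step.
pose st := fix st n := if n is n'.+1 then f (st n', n') else (0%N, fun=> false).
have stP n : cyl (st n) (st n.+1) n by exact: fP.
have st_ge n : (n <= (st n).1)%N.
  elim: n => [//|n ih]; have [h _ _] := stP n; exact: leq_ltn_trans ih h.
have st_mono n n' : (n <= n')%N -> ((st n).1 <= (st n').1)%N.
  move=> /subnK <-; elim: (n' - n)%N => [//|j ih]; rewrite addSn.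
  have [h _ _] := stP (j + n)%N; exact: leq_trans ih (ltnW h).
have st_agree n n' i : (n <= n')%N -> (i < (st n).1)%N ->
    (st n).2 i = (st n').2 i.
  move=> /subnK <- ilt; elim: (n' - n)%N => [//|j ih]; rewrite addSn ih.
  have [_ h _] := stP (j + n)%N; apply: h; apply: leq_trans ilt _.
  by apply: st_mono; exact: leq_addl.
pose B i := (st i.+1).2 i.
have BE n i : (i < (st n).1)%N -> (st n).2 i = B i.
  move=> ilt; have [ni|ni] := leqP n i.+1; first exact: st_agree.
  by rewrite /B -(@st_agree i.+1 n i (ltnW ni) (st_ge i.+1)).
have [j jP] := cP B e e0.
have [_ _ /(_ B (BE j.+1))] := stP j.
by move=> /lt_trans /(_ jP); rewrite ltxx.
Qed.

(** On the cylinder provided by Baire's theorem, the values of [s] with and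
    without the index [n] differ by [z n]. *)
Lemma orlicz_pettis (e : R) : 0 < e ->
  exists N, forall n, (N <= n)%N -> rnorm (z n) <= e.
Proof.
move=> e0; have [N [A [c cP]]] := subsum_cylinder (divr_gt0 e0 (ltr0Sn R 1)).
exists N => n Nn.
pose B0 := truncate A N; pose B1 i := B0 i || (i == n).
have B0n i : (N <= i)%N -> B0 i = false.
  by move=> Ni; rewrite /B0 /truncate ltnNge Ni andbF.
have zE : z n = s B1 - s B0.
  rewrite (@s_finite B1 n.+1) => [|i]; last first.
    by move=> ni; rewrite /B1 B0n ?gtn_eqF// (leq_trans Nn)// ltnW.
  rewrite (@s_finite B0 n.+1) => [|i ni]; last first.
    by rewrite B0n// (leq_trans Nn)// ltnW.
  rewrite !big_nat_recr//= {2}/B1 eqxx orbT B0n// addr0 addrAC.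
  rewrite [X in X - _](_ : _ = \sum_(0 <= i < n) if B0 i then z i else 0).
    by rewrite subrr add0r.
  by apply: eq_big_nat => i /andP[_ ilt]; rewrite /B1 (ltn_eqF ilt) orbF.
have h0 : rnorm (s B0 - c) <= e / 2.
  by apply: cP => i iN; rewrite /B0 /truncate iN andbT.
have h1 : rnorm (s B1 - c) <= e / 2.
  apply: cP => i iN; rewrite /B1 /B0 /truncate iN andbT ltn_eqF ?orbF//.
  exact: leq_trans iN Nn.
rewrite zE -(subrK c (s B1)) -addrA (le_trans (rnormD _ _))//.
by rewrite [leRHS]splitr lerD// rnormB.
Qed.

End orlicz_pettis.

(** * Weakly regular measures are regular *)

Section weakly_regular.
Variables (R : realType) (k : scalar_kind) (Omega : compactHausdorffType).
Local Notation K := (scalars R k).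
Variable Z : normedModType K.
Variable m : set Omega -> Z.
Hypothesis fm : finitely_additive m.
Hypothesis rm : forall w : dual Z, regular_measure (fun E => w (m E) : K^o).

Let fwm (w : dual Z) : finitely_additive (fun E => w (m E) : K^o).
Proof. exact: (finitely_additive_bop w fm). Qed.

(** The Orlicz-Pettis theorem applies: the measure of a union of sets [E i]
    depends weakly continuously on the set of indices, because each [w \o m] has
    small semivariation on the tails. *)
Lemma weakly_regular_exhaustive (E : nat -> set Omega) (e : R) :
  (forall n, borel (E n)) -> trivIset setT E -> 0 < e ->
  exists N, forall n, (N <= n)%N -> rnorm (m (E n)) <= e.
Proof.
move=> bE tE e0.
pose s (A : nat -> bool) := m (\bigcup_(i in [set i | A i]) E i).
apply: (@orlicz_pettis _ _ _ (fun n => m (E n)) s) => //; last first.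
  move=> A N AN; rewrite -finitely_additive_bigcup// /s; congr m.
  apply: eq_bigcupl; split=> i /=; last by case.
  by move=> Ai; split=> //; rewrite ltnNge; apply/negP => /AN; rewrite Ai.
move=> w d d0.
pose B n := \bigcup_(i in [set i | (n <= i)%N]) E i.
have bB n : borel (B n) by apply: borel_bigcup => i _; exact: bE.
have d2 : 0 < d / 2 by rewrite divr_gt0.
have [|N /(_ N (leqnn N)) NP] :=
    semivar_tail (fwm w) (rm w) bB _ (tail_cap0 tE) d2.
  by move=> n v [i /= ni Ev]; exists i => //=; exact: ltnW.
exists N => A A' AA'.
pose hd (A : nat -> bool) := \bigcup_(i in [set i | A i /\ (i < N)%N]) E i.
pose tl (A : nat -> bool) := \bigcup_(i in [set i | A i /\ (N <= i)%N]) E i.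
have btl C : borel (tl C) by apply: borel_bigcup => i _; exact: bE.
have sE C : s C = m (hd C) + m (tl C).
  rewrite -fm //; last 2 first.
  - by apply: borel_bigcup => i _; exact: bE.
  - rewrite -subset0 => v [[i [_ /= iN] Eiv] [j [_ /= jN] Ejv]].
    have ij : i = j by apply: tE => //; exists v.
    by rewrite ij ltnNge jN in iN.
  rewrite /s; congr m; apply/seteqP; split=> v.
    move=> [i /= Ci Ev]; have [Ni|Ni] := leqP N i; [right|left]; by exists i.
  by move=> [[i [Ci _] Ev]|[i [Ci _] Ev]]; exists i.
have wtl C : rnorm (w (m (tl C))) <= d / 2.
  apply: (semivar_le_norm (bB N) (btl C) (fwm w) NP).
  by move=> v [i [_ Ni] Ev]; exists i.
have -> : w (s A) - w (s A') = w (m (tl A)) - w (m (tl A')).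
  rewrite !sE !bopD; have -> : hd A = hd A'.
    by apply: eq_bigcupl; split=> i /= [Ai iN]; split=> //; rewrite ?AA'// -AA'.
  by rewrite opprD addrACA subrr add0r.
by rewrite (le_trans (rnormD _ _))// rnormN [leRHS]splitr lerD.
Qed.

(** A shell [U `\` C] around [E] of large semivariation can be shrunk, by the
    regularity of [w \o m] for a suitable functional [w], so that the part
    removed contains a set of large measure. Half of [e] may remain in the
    smaller shell for [w \o m], and a factor [4] is lost by passing from sums
    of moduli to the modulus of one sum, whence [e / 8]. *)
Lemma shrink_shell (E C U : set Omega) (e : R) : borel E -> 0 < e ->
  compact C -> open U -> C `<=` E -> E `<=` U -> ~ semivar_le m (U `\` C) e ->
  exists C' U' G, [/\ [/\ compact C', open U', C' `<=` E & E `<=` U'],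
    [/\ C `<=` C', U' `<=` U, borel G & G `<=` (U `\` C) `\` (U' `\` C')] &
    e / 8 <= rnorm (m G)].
Proof.
move=> bE e0 cC oU CE EU large.
have bUC : borel (U `\` C).
  by apply: borelD; [exact: borel_open|exact: compact_borel].
have [I [A [a [bA tA AUC a1 large_sum]]]] : exists (I : finType)
    (A : I -> set Omega) (a : I -> K), [/\ forall i, borel (A i),
    trivIset setT A, forall i, A i `<=` U `\` C, forall i, rnorm (a i) <= 1 &
    e < rnorm (\sum_i a i *: m (A i))].
  apply: contrapT => H; apply: large.
  apply/semivar_leP => // I A a bA tA AUC a1.
  by rewrite leNgt; apply/negP => ?; apply: H; exists I, A, a.
have [w [w1 wA]] := norming_functional (\sum_i a i *: m (A i)).
have e2 : 0 < e / 2 by rewrite divr_gt0.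
have [C1 [U1 [cC1 oU1 CE1 EU1 /ltW mUC1]]] := rm w bE e2.
pose C' := C `|` C1; pose U' := U `&` U1; pose D := (U `\` C) `\` (U' `\` C').
have bC1 := compact_borel cC1; have bU1 := borel_open oU1.
have bC := compact_borel cC; have bU := borel_open oU.
have bUC' : borel (U' `\` C') by apply: borelD; [exact: borelI|exact: borelU].
have bD : borel D by exact: borelD.
have tAD : trivIset setT (fun i => A i `&` D).
  by move=> i j _ _ [v [[? _] [? _]]]; apply: tA => //; exists v.
have small : rnorm (\sum_i a i *: (w (m (A i `\` D)) : K^o)) <= e / 2.
  rewrite -[leRHS]mul1r.
  apply: (semivar_le_sum (F := U1 `\` C1) _ (fwm w)) => //.
  - exact: borelD.
  - by move=> i; exact: borelD.
  - by move=> i j _ _ [v [[? _] [? _]]]; apply: tA => //; exists v.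
  - move=> i v [Av nDv]; have UCv := AUC i v Av.
    have : (U' `\` C') v by apply: contrapT => ?; apply: nDv.
    by move=> [[_ ?]]; rewrite not_orP => -[].
have mAD i : m (A i) = m (A i `&` D) + m (A i `\` D).
  rewrite -fm; first by rewrite setDE -setIUr setUv setIT.
  - exact: borelI.
  - exact: borelD.
  - by rewrite setDE setIACA setICr setI0.
have big_part : e / 2 <= \sum_i rnorm (w (m (A i `&` D))).
  have wE : w (\sum_i a i *: m (A i)) =
      \sum_i a i *: (w (m (A i `&` D)) : K^o) +
      \sum_i a i *: (w (m (A i `\` D)) : K^o).
    rewrite bop_sum -big_split; apply: eq_bigr => i _ /=.
    by rewrite bopZ mAD bopD scalerDr.
  have h1 : rnorm (\sum_i a i *: (w (m (A i `&` D)) : K^o)) <=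
      \sum_i rnorm (w (m (A i `&` D))).
    rewrite (le_trans (rnorm_sum _ _ _))//; apply: ler_sum => i _.
    by rewrite rnormZ ler_piMl// rnorm_ge0.
  have := rnormD (\sum_i a i *: (w (m (A i `&` D)) : K^o))
    (\sum_i a i *: (w (m (A i `\` D)) : K^o)).
  rewrite -wE; move: wA large_sum small h1; lra.
have [S SP] := subset_sum_ge (fun i => w (m (A i `&` D)) : K).
pose G := \bigcup_(i in [set` S]) (A i `&` D).
have GE : G = \big[setU/set0]_(i in S) (A i `&` D) by rewrite /G bigcup_pred.
have bG : borel G.
  rewrite GE; elim/big_ind : _ => [|? ? ? ?|i _].
  - exact: borel0.
  - exact: borelU.
  - exact: borelI.
have GD : G `<=` D by move=> v [i _ []].
exists C', U', G; split; [split|split|] => //.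
- exact: compactU.
- exact: openI.
- by move=> v [/CE|/CE1].
- by move=> v Ev; split; [exact: EU|exact: EU1].
- exact: subsetUl.
- exact: subIsetl.
have mG : m G = \sum_(i | S i) m (A i `&` D).
  rewrite (@finitely_additive_cover _ _ _ _ m _ (fun i => A i `&` D))//.
  - rewrite [RHS]big_mkcond; apply: eq_bigr => i _; case: ifPn => Si.
      congr m; apply/seteqP; split=> v; first by case.
      by move=> Av; split=> //; exists i.
    rewrite (_ : _ `&` _ = set0) ?finitely_additive0//.
    rewrite -subset0 => v [[j /= Sj [Ajv _]] [Aiv _]].
    have ij : i = j by apply: tA => //; exists v.
    by rewrite ij in Si; move/negP: Si.
  - by move=> i; exact: borelI.
  - by move=> v [i _ Av]; exists i.
have := w1 (m G); rewrite mG bop_sum -mG.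
by move: SP big_part; lra.
Qed.

(** Otherwise all the shells around some [E] have a large semivariation.
    Shrinking them repeatedly removes disjoint sets of measures bounded below,
    which contradicts [weakly_regular_exhaustive]. *)
Lemma weakly_regular_regular : regular_measure m.
Proof.
move=> E e bE e0; apply: contrapT => H.
have e2 : 0 < e / 2 by rewrite divr_gt0.
pose shell (CU : set Omega * set Omega) :=
  [/\ compact CU.1, open CU.2, CU.1 `<=` E & E `<=` CU.2].
pose next (p q : set Omega * set Omega) G :=
  [/\ p.1 `<=` q.1, q.2 `<=` p.2, borel G &
    G `<=` (p.2 `\` p.1) `\` (q.2 `\` q.1)] /\ e / 2 / 8 <= rnorm (m G).
have step (p : set Omega * set Omega) : exists qG : _ * set Omega,
    shell p -> shell qG.1 /\ next p qG.1 qG.2.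
  have [[cC oU CE EU]|np] := pselect (shell p); last by exists (p, set0).
  have [|C' [U' [G [h1 h2 h3]]]] := shrink_shell bE e2 cC oU CE EU.
    move=> small; apply: H; exists p.1, p.2; split=> //.
    apply: le_lt_trans small _.
    by rewrite lte_fin ltr_pdivrMr// mulr_natr mulr2n ltrDl.
  by exists ((C', U'), G).
have [f fP] := choice step.
pose st n := iter n (fun p => (f p).1) (set0, setT).
have stS n : shell (st n).
  elim: n => [|n ih]; first by split=> //=; [exact: compact0|exact: openT].
  by have [] := fP _ ih.
pose G n := (f (st n)).2.
have stG n : next (st n) (st n.+1) (G n) by have [] := fP _ (stS n).
pose V n := (st n).2 `\` (st n).1.
have dV n n' : (n <= n')%N -> V n' `<=` V n.
  move=> /subnK <-; elim: (n' - n)%N => [//|j ih]; rewrite addSn.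
  apply: subset_trans ih => v [Uv Cv]; have [[CC UU _ _] _] := stG (j + n)%N.
  by split; [exact: UU|move=> /CC].
have GV n v : G n v -> V n v /\ ~ V n.+1 v.
  by have [[_ _ _ GV] _] := stG n => /GV[].
have tG : trivIset setT G.
  have lt_disj i j v : (i < j)%N -> G i v -> G j v -> False.
    by move=> ij /GV[_ nV] /GV[Vj _]; apply: nV; exact: dV Vj.
  move=> i j _ _ [v [Giv Gjv]].
  by case: (ltngtP i j) => // ij; [case: (lt_disj i j v)|case: (lt_disj j i v)].
have bG n : borel (G n) by have [[_ _ ? _] _] := stG n.
have e32 : 0 < e / 2 / 16 by rewrite !divr_gt0.
have [N /(_ N (leqnn N))] := weakly_regular_exhaustive bG tG e32.
by have [_] := stG N; move: e0; lra.
Qed.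

End weakly_regular.

(** * The representing measures *)

Section representing.
Variables (R : realType) (k : scalar_kind) (Omega : compactHausdorffType).
Local Notation K := (scalars R k).

Lemma dual_cauchy_complete (Z : normedModType K) : cauchy_complete (dual Z).
Proof. by apply: bop_cauchy_complete; exact: scalar_cauchy_complete. Qed.

Variables X Y : normedModType K.

(** The elementary tensor of [x] and [y], acting on operators. *)
Definition tensor_functional (x : X) (y : dual Y) : dual (bop X Y) :=
  bcomp y (evaluation Y x).

Lemma classical_functional (Z : normedModType K)
    (T : bop (cfun Omega K^o) Z) (G : set Omega -> bidual Z) (w : dual Z) :
  classical_representing_measure T G ->
  [/\ finitely_additive (fun E => G E w : K^o),
      bounded_measure (fun E => G E w : K^o),
      regular_measure (fun E => G E w : K^o) &
      forall phi : cfun Omega K^o,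
        is_vector_integral (fun E => G E w : K^o) phi (w (T phi))].
Proof.
move=> [fG bG rG iG]; split.
- exact: (finitely_additive_bop (eval_at w) fG).
- exact: (bounded_measure_bop (eval_at w) fG bG).
- exact: rG.
- move=> phi; rewrite (_ : w (T phi) = canonical_embedding Z (T phi) w)// iG.
  apply: (is_vector_integral_bop (eval_at w)).
  exact: (vector_integralP phi (@dual_cauchy_complete _) fG bG).
Qed.

Lemma representing_functional (p : \bar R) (U : cfun Omega X -> Y)
    (m : set Omega -> bop X (bidual Y)) (x : X) (y : dual Y) :
  (1 <= p)%E -> representing_measure p U m ->
  [/\ finitely_additive (fun E => m E x y : K^o),
      bounded_measure (fun E => m E x y : K^o),
      regular_measure (fun E => m E x y : K^o) &
      forall phi : cfun Omega K^o, is_vector_integral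
        (fun E => m E x y : K^o) phi (y (U (cfun_scale phi x)))].
Proof.
move=> p1 [fm [bm _] rm [J [_ JE] UJ]].
pose L : bop (bop X (bidual Y)) K^o :=
  bcomp (eval_at y) (evaluation (bidual Y) x).
split.
- exact: (finitely_additive_bop L fm).
- exact: (bounded_measure_bop L fm bm).
- exact: (rm y x).
- move=> phi.
  rewrite (_ : y _ = canonical_embedding Y (U (cfun_scale phi x)) y)//.
  rewrite UJ; last exact: Cp_cfun_scale.
  rewrite JE.
  apply: (is_vector_integral_bop L).
  apply: (vector_integralP phi _ fm bm).
  by apply: bop_cauchy_complete; exact: dual_cauchy_complete.
Qed.

Lemma representing_classical (p : \bar R) (U : cfun Omega X -> Y)
    (m : set Omega -> bop X (bidual Y)) (Us : bop (cfun Omega K^o) (bop X Y))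
    (mu : set Omega -> bidual (bop X Y)) (x : X) (y : dual Y) E :
  (1 <= p)%E -> representing_measure p U m ->
  (forall phi x, Us phi x = U (cfun_scale phi x)) ->
  classical_representing_measure Us mu -> borel E ->
  m E x y = mu E (tensor_functional x y).
Proof.
move=> p1 hm hUs hmu bE.
have [f1 b1 r1 i1] := representing_functional x y p1 hm.
have [f2 b2 r2 i2] := classical_functional (tensor_functional x y) hmu.
apply: (regular_measures_eq f1 f2 b1 b2 r1 r2 _ bE) => phi.
exists (y (U (cfun_scale phi x))); split; first exact: i1.
by rewrite -hUs; exact: i2.
Qed.

(** By the choice of bump functions, [G E] is a weak-star limit of elements of
    the image of the unit ball. *)
Lemma weakly_compact_classical (Z : normedModType K)
    (T : bop (cfun Omega K^o) Z) (G : set Omega -> bidual Z) E :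
  classical_representing_measure T G -> weakly_compact T -> borel E ->
  exists z, G E = canonical_embedding Z z.
Proof.
move=> hG wT bE; apply: (weakly_compact_bidual wT) => l e e0.
pose nu (w : dual Z) (E : set Omega) : K^o := G E w.
have [|||phi [phi1 phiP]] := common_bump (nu := nu) (l := l) _ _ _ bE e0.
- by move=> w _; have [] := classical_functional w hG.
- by move=> w _; have [] := classical_functional w hG.
- by move=> w _; have [] := classical_functional w hG.
exists phi.
  by rewrite /rnorm ofRK supnorm_le.
by move=> w wl; apply: phiP => //; have [] := classical_functional w hG.
Qed.

End representing.

Theorem corollary4p6 (R : realType) (k : scalar_kind)
    (X Y : completeNormedModType (scalars R k)) (Omega : compactHausdorffType)
    (p : \bar R) (hp : (1 <= p)%E)
    (U : cfun Omega X -> Y) (hU : Cp_bounded_linear p U)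
    (m : set Omega -> bop X (bidual Y)) (hm : representing_measure p U m)
    (Us : bop (cfun Omega (scalars R k)^o) (bop X Y))
    (hUs : forall phi x, Us phi x = U (cfun_scale phi x))
    (mu : set Omega -> bidual (bop X Y))
    (hmu : classical_representing_measure Us mu)
    (* the projective tensor product of X and the dual of Y *)
    (T : completeNormedModType (scalars R k)) (t : X -> dual Y -> T)
    (hT : projective_tensor t)
    (* the identification of L(X, Y^** ) with the dual of T *)
    (iota : bop (bop X (bidual Y)) (dual T))
    (hiota : forall A x y, iota A (t x y) = A x y)
    (* P is the adjoint of the canonical embedding of T, up to iota *)
    (P : bop (bidual (bop X (bidual Y))) (bop X (bidual Y)))
    (hP : forall Phi,
      iota (P Phi) = adjoint (canonical_embedding T) (biadjoint iota Phi)) :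
  (forall E, borel E ->
     m E = P (biadjoint (postcomp X (canonical_embedding Y)) (mu E))) /\
  (weakly_compact Us ->
    exists m0 : set Omega -> bop X Y,
      [/\ forall E, borel E -> m E = postcomp X (canonical_embedding Y) (m0 E),
          forall E, borel E -> mu E = canonical_embedding (bop X Y) (m0 E),
          countably_additive m0 & regular_measure m0]).
Proof.
have mE x y E : borel E -> m E x y = mu E (tensor_functional x y).
  exact: (representing_classical x y hp hm hUs hmu).
split=> [E bE|wc].
  apply: bop_eqP => x; apply: bop_eqP => y.
  rewrite mE// -[RHS]hiota hP /=.
  congr (mu E _); apply: bop_eqP => A /=.
  by rewrite hiota.
have /choice[m0 m0P] E :
    exists z, borel E -> mu E = canonical_embedding (bop X Y) z.
  have [bE|nE] := pselect (borel E); last by exists 0.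
  by have [z zE] := weakly_compact_classical hmu wc bE; exists z.
have fm0 : finitely_additive m0.
  move=> A B bA bB AB; apply: canonical_embedding_inj.
  by rewrite bopD -!m0P//; [exact: (classical_additive hmu)|exact: borelU].
have rm0 : forall w : dual (bop X Y),
    regular_measure (fun E => w (m0 E) : (scalars R k)^o).
  move=> w; have [_ _ rmu _] := classical_functional w hmu.
  by apply: eq_regular_measure rmu => E bE; rewrite m0P.
have rm := weakly_regular_regular fm0 rm0.
exists m0; split=> //; last exact: regular_countably_additive.
move=> E bE; apply: bop_eqP => x; apply: bop_eqP => y.
by rewrite mE// m0P.
Qed.
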